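(* Let $A$ and $B$ be $m\times n$ complex matrices and let $\alpha,c>0$ be real numbers. Consider the constrained minimization problem $$\text{(P1)}\qquad \inf_{\det D_\ell^2\,\det D_r^2=c}\ 2\left(\|D_\ell AD_r\|_F^2+\|D_\ell BD_r\|_F^2\right)+\alpha^2\left(\frac{1}{m^2}\|D_\ell\|_F^4+\frac{1}{n^2}\|D_r\|_F^4\right)$$ over the set $\{(D_\ell,D_r) : D_\ell=\mathrm{diag}(\delta_{\ell_1},\ldots,\delta_{\ell_m}),\ D_r=\mathrm{diag}(\delta_{r_1},\ldots,\delta_{r_n}),\ \delta_{\ell_i}>0,\ \delta_{r_j}>0\}$. Let $M:=|A|^{\circ 2}+|B|^{\circ 2}$, and let $M_\alpha$ be the nonnegative matrix whose elementwise square is $$M_\alpha^{\circ 2}=\begin{bmatrix}\frac{\alpha^2}{m^2}\mathbf{1}_m\mathbf{1}_m^T & M\\ M^T & \frac{\alpha^2}{n^2}\mathbf{1}_n\mathbf{1}_n^T\end{bmatrix}.$$ Then the following statements hold: a) Problem (P1) is equivalent to the optimization problem (over the same set) $$\inf_{\det D_\ell^2\,\det D_r^2=c}\ \mathbf{1}_{m+n}^T\begin{bmatrix}\frac{\alpha^2}{m^2}D_\ell^2\mathbf{1}_m\mathbf{1}_m^TD_\ell^2 & D_\ell^2MD_r^2\\ D_r^2M^TD_\ell^2 & \frac{\alpha^2}{n^2}D_r^2\mathbf{1}_n\mathbf{1}_n^TD_r^2\end{bmatrix}\mathbf{1}_{m+n}.$$ b) Problem (P1) is equivalent to the optimization problem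 (over the same set) $$\inf_{\det D_\ell^2\,\det D_r^2=c}\ \left\|\begin{bmatrix}D_\ell&0\\0&D_r\end{bmatrix}M_\alpha\begin{bmatrix}D_\ell&0\\0&D_r\end{bmatrix}\right\|_F^2.$$ c) There exists a unique solution $(\widetilde D_\ell,\widetilde D_r)$ of (P1). Moreover, $(\widetilde D_\ell,\widetilde D_r)$ is bounded and makes the matrix $$\begin{bmatrix}\widetilde D_\ell^2&0\\0&\widetilde D_r^2\end{bmatrix}M_\alpha^{\circ 2}\begin{bmatrix}\widetilde D_\ell^2&0\\0&\widetilde D_r^2\end{bmatrix}$$ a scalar multiple of a doubly stochastic matrix. Therefore, $(\widetilde D_\ell,\widetilde D_r)$ can be computed, up to a scalar multiple, by applying the Sinkhorn-Knopp-like algorithm (described in the context) to $M_\alpha^{\circ 2}$ with prescribed row and column sums $r=c=\mathbf{1}_{m+n}$ (here $c$ denotes the vector of prescribed column sums, not the real number $c$ in the constraint of (P1)).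
   Context: $\mathbf{1}_k=[1,\ldots,1]^T\in\mathbb{R}^k$; $|X|$ is the elementwise absolute value and $X^{\circ 2}$ the elementwise square of $X$; $\|\cdot\|_F$ is the Frobenius norm. Two optimization problems are ''equivalent'' here if they have the same feasible set and the same objective function on it. ''Solution'' means a minimizer (attained infimum) in the given set; ''bounded'' means its diagonal entries are finite positive numbers. A doubly stochastic matrix is a square nonnegative matrix whose row and column sums all equal $1$. Sinkhorn-Knopp-like algorithm for a nonnegative matrix $N$ with prescribed positive row sums $r$ and column sums $c$ of equal total: first multiply $N$ by the scalar $s=(\sum_j c_j)/(\sum_{i,j}N_{ij})$, initializing the left and right diagonal scalings as $\sqrt{s}\,I$; then alternately (i) divide each column $j$ of the current matrix, and the $j$-th diagonal entry of the right scaling, by (current $j$-th column sum)$/c_j$, and (ii) divide each row $i$ of the current matrix, and the $i$-th diagonal entry of the left scaling, by (current $i$-th row sum)$/r_i$, until, for the updating factors in (i) and for those in (ii), the ratio of the smallest to the largest factor is within a prescribed tolerance of $1$ (or a maximum number of iterations is reached); finally multiply the left scaling by a positive scalar and divide the right scaling by the same scalar so that the two scalings have equal maximal diagonal entries. The output is the scaled matrix together with the left and right diagonal scalings; when it is applied to $M_\alpha^{\circ 2}$, the scalings sought are those of the squared form $\mathrm{diag}(D_\ell^2,D_r^2)$.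
   Formalization: If A = B = 0 and m ≠ n, the algorithm's left and right scalings are not multiples of diag(D_ℓ², D_r²); in that case only their product is claimed to be a multiple of its square. Otherwise both scalings tend to that multiple as the tolerance tends to 0. *)

(* Defs.v *)
From HB Require Import structures.
From mathcomp Require Import all_boot all_order all_algebra.
From mathcomp Require Import complex.
From mathcomp Require Import boolp classical_sets reals.

Set Implicit Arguments.
Unset Strict Implicit.
Unset Printing Implicit Defensive.

Import Order.TTheory GRing.Theory Num.Theory.

Local Open Scope ring_scope.
Local Open Scope complex_scope.

Section Matrices.
Context {R : realType}.

Definition abs_mx m n (A : 'M[R[i]]_(m, n)) : 'M[R]_(m, n) :=
  map_mx (@ComplexField.Normc.normc R) A.

Definition esq_mx m n (X : 'M[R]_(m, n)) : 'M[R]_(m, n) :=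
  map_mx (fun x => x ^+ 2) X.

Definition cplx_mx m n (X : 'M[R]_(m, n)) : 'M[R[i]]_(m, n) :=
  map_mx (real_complex R) X.

Definition frobenius m n (A : 'M[R[i]]_(m, n)) : R :=
  Num.sqrt (\sum_i \sum_j abs_mx A i j ^+ 2).

Definition ones k : 'cV[R]_k := const_mx 1.

Definition posdiag k (D : 'M[R]_k) : Prop :=
  is_diag_mx D /\ forall i, 0 < D i i.

Definition doubly_stochastic k (P : 'M[R]_k) : Prop :=
  [/\ forall i j, 0 <= P i j,
      forall i, \sum_j P i j = 1
    & forall j, \sum_i P i j = 1].

End Matrices.

Record minimization (R : realType) (T : Type) := Minimization {
  feasible : set T;
  objective : T -> R }.

Definition equivalent (R : realType) T (P Q : minimization R T) : Prop :=
  feasible P = feasible Q /\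
  forall x, feasible P x -> objective P x = objective Q x.

Definition solution (R : realType) T (P : minimization R T) (x : T) : Prop :=
  feasible P x /\ forall y, feasible P y -> objective P x <= objective P y.

Section Problems.
Context {R : realType} {m n : nat}.
Local Notation scalings := ('M[R]_m * 'M[R]_n)%type.

Definition scaling_set (c : R) : set scalings :=
  [set D | [/\ posdiag D.1, posdiag D.2 &
               \det (D.1 ^+ 2) * \det (D.2 ^+ 2) = c]]%classic.

Definition scaling_problem (A B : 'M[R[i]]_(m, n)) (alpha c : R) :
    minimization R scalings :=
  Minimization (scaling_set c) (fun D =>
    2 * (frobenius (cplx_mx D.1 *m A *m cplx_mx D.2) ^+ 2 +
         frobenius (cplx_mx D.1 *m B *m cplx_mx D.2) ^+ 2) +
    alpha ^+ 2 * ((m%:R ^+ 2)^-1 * frobenius (cplx_mx D.1) ^+ 4 +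
                  (n%:R ^+ 2)^-1 * frobenius (cplx_mx D.2) ^+ 4)).

Definition sum_abs_sq (A B : 'M[R[i]]_(m, n)) : 'M[R]_(m, n) :=
  esq_mx (abs_mx A) + esq_mx (abs_mx B).

Definition Malpha_sq (A B : 'M[R[i]]_(m, n)) (alpha : R) : 'M[R]_(m + n) :=
  block_mx
    ((alpha ^+ 2 / m%:R ^+ 2) *: (ones m *m (ones m)^T)) (sum_abs_sq A B)
    (sum_abs_sq A B)^T ((alpha ^+ 2 / n%:R ^+ 2) *: (ones n *m (ones n)^T)).

Definition entry_sum_problem (A B : 'M[R[i]]_(m, n)) (alpha c : R) :
    minimization R scalings :=
  Minimization (scaling_set c) (fun D =>
    let M := sum_abs_sq A B in
    let Dl2 := D.1 ^+ 2 in
    let Dr2 := D.2 ^+ 2 in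
    ((ones (m + n))^T *m
     block_mx
       ((alpha ^+ 2 / m%:R ^+ 2) *: (Dl2 *m ones m *m (ones m)^T *m Dl2))
       (Dl2 *m M *m Dr2)
       (Dr2 *m M^T *m Dl2)
       ((alpha ^+ 2 / n%:R ^+ 2) *: (Dr2 *m ones n *m (ones n)^T *m Dr2))
     *m ones (m + n)) 0 0).

Definition frobenius_problem (Malpha : 'M[R]_(m + n)) (c : R) :
    minimization R scalings :=
  Minimization (scaling_set c) (fun D =>
    let D12 := block_mx D.1 0 0 D.2 in
    frobenius (cplx_mx (D12 *m Malpha *m D12)) ^+ 2).

End Problems.

Section SinkhornKnopp.
Context {R : realType} {p q : nat}.

(* The scalings are stored as the vectors of their diagonal entries. *)
Record sk_state := SkState {
  sk_mx : 'M[R]_(p, q);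
  sk_left : 'rV[R]_p;
  sk_right : 'rV[R]_q }.

Definition vmax k (v : 'rV[R]_k) : R := \big[Num.max/0]_i v 0 i.

(* The default value vmax v does not alter the minimum, and vmax v is the
   maximum when the entries of v are nonnegative, as they always are here. *)
Definition vmin k (v : 'rV[R]_k) : R := \big[Num.min/vmax v]_i v 0 i.

Definition sk_init (N : 'M[R]_(p, q)) (c : 'rV[R]_q) : sk_state :=
  let s := (\sum_j c 0 j) / (\sum_i \sum_j N i j) in
  SkState (s *: N) (const_mx (Num.sqrt s)) (const_mx (Num.sqrt s)).

Definition sk_col_factors (c : 'rV[R]_q) (S : sk_state) : 'rV[R]_q :=
  \row_j ((\sum_i sk_mx S i j) / c 0 j).

Definition sk_col_step (c : 'rV[R]_q) (S : sk_state) : sk_state :=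
  let f := sk_col_factors c S in
  SkState (\matrix_(i, j) (sk_mx S i j / f 0 j))
          (sk_left S)
          (\row_j (sk_right S 0 j / f 0 j)).

Definition sk_row_factors (r : 'rV[R]_p) (S : sk_state) : 'rV[R]_p :=
  \row_i ((\sum_j sk_mx S i j) / r 0 i).

Definition sk_row_step (r : 'rV[R]_p) (S : sk_state) : sk_state :=
  let f := sk_row_factors r S in
  SkState (\matrix_(i, j) (sk_mx S i j / f 0 i))
          (\row_i (sk_left S 0 i / f 0 i))
          (sk_right S).

Definition sk_pass (r : 'rV[R]_p) (c : 'rV[R]_q) (S : sk_state) : sk_state :=
  sk_row_step r (sk_col_step c S).

(* Stopping test at the end of the pass that starts from the state S. *)
Definition sk_stop (r : 'rV[R]_p) (c : 'rV[R]_q) (tol : R) (S : sk_state) :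
    bool :=
  let fc := sk_col_factors c S in
  let fr := sk_row_factors r (sk_col_step c S) in
  (`|vmin fc / vmax fc - 1| <= tol) && (`|vmin fr / vmax fr - 1| <= tol).

(* The boolean tells whether the stopping test succeeded within kmax passes. *)
Fixpoint sk_loop (r : 'rV[R]_p) (c : 'rV[R]_q) (tol : R) (kmax : nat)
    (S : sk_state) : bool * sk_state :=
  if kmax is k.+1 then
    if sk_stop r c tol S then (true, sk_pass r c S)
    else sk_loop r c tol k (sk_pass r c S)
  else (false, S).

(* The scalar t solves t * vmax (sk_left S) = vmax (sk_right S) / t. *)
Definition sk_balance (S : sk_state) : sk_state :=
  let t := Num.sqrt (vmax (sk_right S) / vmax (sk_left S)) in
  SkState (sk_mx S) (t *: sk_left S) (t^-1 *: sk_right S).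

Definition sinkhorn_knopp (N : 'M[R]_(p, q)) (r : 'rV[R]_p) (c : 'rV[R]_q)
    (tol : R) (kmax : nat) : bool * sk_state :=
  let: (stopped, st) := sk_loop r c tol kmax (sk_init N c) in
  (stopped, sk_balance st).

Definition mx_close k l (eps : R) (X Y : 'M[R]_(k, l)) : Prop :=
  forall i j, `|X i j - Y i j| <= eps.

(* In exact arithmetic, the algorithm terminates by its stopping test for every
   small tolerance (if allowed enough iterations), with an output that tends to
   (X, L, Rt) as the tolerance tends to 0. *)
Definition sk_computes (N : 'M[R]_(p, q)) (r : 'rV[R]_p) (c : 'rV[R]_q)
    (X : 'M[R]_(p, q)) (L : 'M[R]_p) (Rt : 'M[R]_q) : Prop :=
  forall eps : R, 0 < eps -> exists2 tol0 : R, 0 < tol0 &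
  forall tol : R, 0 < tol <= tol0 -> exists K : nat,
  forall kmax : nat, (K <= kmax)%N ->
    let: (stopped, st) := sinkhorn_knopp N r c tol kmax in
    [/\ stopped, mx_close eps (sk_mx st) X,
        mx_close eps (diag_mx (sk_left st)) L
      & mx_close eps (diag_mx (sk_right st)) Rt].

End SinkhornKnopp.

(* Main.v *)
Require Import Defs.
From HB Require Import structures.
From mathcomp Require Import all_boot all_order all_algebra.
From mathcomp Require Import complex.
From mathcomp Require Import boolp classical_sets reals.
From mathcomp Require Import functions filter topology normedtype sequences.
From mathcomp Require Import derive realfun exp.
From mathcomp Require Import ring lra.

Set Implicit Arguments.
Unset Strict Implicit.
Unset Printing Implicit Defensive.

Import Order.TTheory GRing.Theory Num.Theory.
Import numFieldNormedType.Exports.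

Local Open Scope ring_scope.
Local Open Scope complex_scope.

(** Let [x] be the vector of the diagonal entries of [D_l ^+ 2] and
    [D_r ^+ 2], and let [N] be the symmetric nonnegative matrix [Malpha_sq].
    On positive diagonal matrices all three objectives equal the quadratic form
    [qform N x], and the constraint says that the product of the entries of [x]
    is [c].  This gives the two equivalences and turns the minimization problem
    into the minimization of [qform N] over positive vectors of product [c].

    The diagonal of [N] is positive, so the sublevel sets of [qform N] under
    the constraint are bounded and stay away from the boundary of the orthant;
    a minimizer [x] exists by compactness ([exists_qform_minimizer]).
    Multiplying one entry of a minimizer by a factor and dividing another one by
    the same factor preserves the constraint; to first order this shows that all
    the numbers [x_i (N x)_i] are equal to one [a > 0] ([minimizer_balanced]),
    that is, that [diag x N diag x] is [a] times a doubly stochastic matrix.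
    Conversely, in the logarithmic coordinates [y_i = x_i exp u_i] the form is
    strictly convex and a balanced [x] is a critical point, so that every other
    feasible vector has a larger value ([balanced_lt_qform]); this is uniqueness.

    For the algorithm let [u = x / sqrt a] and [P = diag u N diag u], which is
    symmetric and doubly stochastic.  Measured in units of [u], each half pass
    replaces a vector [z] by the entrywise inverse of [P z], and a full pass is
    an order preserving, positively homogeneous map that fixes the constants.
    If [A] or [B] is nonzero then all entries of [P ^+ 4] are positive
    ([two_cliques_primitive]), and two such passes move the maximum of [z]
    towards its minimum by a fixed proportion of their distance; hence the left
    scaling converges to a multiple of [u] ([recip_avg2_cvg]).  If [A] and [B]
    vanish then [N] consists of two constant diagonal blocks, and the left
    scaling is fixed from the start ([sinkhorn_left_limit]).  In both cases the
    limit is [u] times a vector that is constant along the nonzero entries of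
    [N], and the final balancing removes this vector when it is constant.

    Convergence of the states yields convergence of the stopped algorithm
    ([sk_computes_cvg]): all updating factors tend to [1], so that the stopping
    test succeeds eventually, and it can succeed early for arbitrarily small
    tolerances only at a state whose factors are all equal, which is then a
    fixed state of the iteration. *)

(** * Limits of finite sums, products and extrema *)

Section BigLimits.
Local Open Scope classical_set_scope.
Local Open Scope ring_scope.
Variables (R : realType) (T : Type) (F : set_system T).
Context {FF : Filter F}.

Lemma cvg_sumr (I : finType) (f : I -> T -> R) (a : I -> R) :
  (forall i, f i @ F --> a i) -> (\sum_i f i t) @[t --> F] --> \sum_i a i.
Proof. by move=> fa; apply: (cvg_big (@add_continuous R)). Qed.

Lemma cvg_prodr (I : finType) (f : I -> T -> R) (a : I -> R) :
  (forall i, f i @ F --> a i) -> (\prod_i f i t) @[t --> F] --> \prod_i a i.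
Proof. by move=> fa; apply: (cvg_big (@mul_continuous R)). Qed.

Lemma cvg_divr (f g : T -> R) (a b : R) : b != 0 ->
  f @ F --> a -> g @ F --> b -> (f t / g t) @[t --> F] --> a / b.
Proof. by move=> b0 fa gb; apply: (cvgM fa (cvgV b0 gb)). Qed.

Lemma cvg_maxr (f g : T -> R) (a b : R) :
  f @ F --> a -> g @ F --> b -> Num.max (f t) (g t) @[t --> F] --> Num.max a b.
Proof.
move=> fa gb; exact: continuous2_cvg (@max_continuous _ R (a, b)) fa gb.
Qed.

Lemma cvg_minr (f g : T -> R) (a b : R) :
  f @ F --> a -> g @ F --> b -> Num.min (f t) (g t) @[t --> F] --> Num.min a b.
Proof.
move=> fa gb; exact: continuous2_cvg (@min_continuous _ R (a, b)) fa gb.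
Qed.

Lemma cvg_vmax k (v : T -> 'rV[R]_k) (w : 'rV[R]_k) :
  (forall i, v t 0 i @[t --> F] --> w 0 i) -> vmax (v t) @[t --> F] --> vmax w.
Proof. by move=> vw; apply: (cvg_big (@max_continuous _ R)) => i _. Qed.

Lemma cvg_vmin k (v : T -> 'rV[R]_k) (w : 'rV[R]_k) :
  (forall i, v t 0 i @[t --> F] --> w 0 i) -> vmin (v t) @[t --> F] --> vmin w.
Proof.
move=> vw; rewrite /vmin.
elim: index_enum => [|i r IH].
  under eq_cvg do rewrite big_nil.
  by rewrite big_nil; exact: cvg_vmax.
under eq_cvg do rewrite big_cons.
by rewrite big_cons; exact: cvg_minr.
Qed.
End BigLimits.

(** * The three objectives as one quadratic form *)

Definition qform (R : realType) k (N : 'M[R]_k) (x : 'rV[R]_k) : R :=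
  \sum_i \sum_j N i j * x 0 i * x 0 j.

Definition sqdiag (R : realType) m n (D : 'M[R]_m * 'M[R]_n) : 'rV[R]_(m + n) :=
  row_mx (\row_i D.1 i i ^+ 2) (\row_j D.2 j j ^+ 2).

Section Objectives.
Variable R : realType.

Lemma posdiag_diag_mx k (D : 'M[R]_k) :
  posdiag D -> D = diag_mx (\row_i D i i).
Proof.
case=> /is_diag_mxP dD _; apply/matrixP => i j; rewrite !mxE.
have [->|nij] := eqVneq i j; first by rewrite mulr1n.
rewrite mulr0n; exact: dD.
Qed.

Lemma posdiag_diag_row k (d : 'rV[R]_k) :
  (forall i, 0 < d 0 i) -> posdiag (diag_mx d).
Proof.
move=> d_gt0; split=> [|i]; first exact: diag_mx_is_diag.
by rewrite mxE eqxx mulr1n.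
Qed.

Lemma diag_mx_sqr k (d : 'rV[R]_k) :
  diag_mx d ^+ 2 = diag_mx (\row_i d 0 i ^+ 2).
Proof.
rewrite expr2 -[_ * _]/(_ *m _) mulmx_diag.
by congr diag_mx; apply/rowP => i; rewrite !mxE expr2.
Qed.

Lemma normc_real (x : R) : ComplexField.Normc.normc x%:C = `|x|.
Proof. by rewrite /ComplexField.Normc.normc /= expr0n addr0 sqrtr_sqr. Qed.

Lemma frobenius_sqr k l (A : 'M[R[i]]_(k, l)) :
  frobenius A ^+ 2 = \sum_i \sum_j abs_mx A i j ^+ 2.
Proof.
rewrite /frobenius sqr_sqrtr // sumr_ge0 // => i _.
by apply: sumr_ge0 => j _; rewrite sqr_ge0.
Qed.

Lemma frobenius_cplx_sqr k l (X : 'M[R]_(k, l)) :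
  frobenius (cplx_mx X) ^+ 2 = \sum_i \sum_j X i j ^+ 2.
Proof.
rewrite frobenius_sqr; apply: eq_bigr => i _; apply: eq_bigr => j _.
by rewrite !mxE normc_real real_normK ?num_real.
Qed.

Lemma frobenius_diag_sqr k (d : 'rV[R]_k) :
  frobenius (cplx_mx (diag_mx d)) ^+ 2 = \sum_i d 0 i ^+ 2.
Proof.
rewrite frobenius_cplx_sqr; apply: eq_bigr => i _.
rewrite (bigD1 i) //= big1 ?addr0 => [|j nji]; rewrite mxE.
  by rewrite eqxx mulr1n.
by rewrite eq_sym (negPf nji) mulr0n expr0n.
Qed.

Lemma cplx_diag_mx k (d : 'rV[R]_k) :
  cplx_mx (diag_mx d) = diag_mx (map_mx (real_complex R) d).
Proof. by rewrite /cplx_mx map_diag_mx. Qed.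

Lemma frobenius_scale_sqr k l (A : 'M[R[i]]_(k, l)) (d : 'rV[R]_k) (e : 'rV[R]_l) :
  frobenius (cplx_mx (diag_mx d) *m A *m cplx_mx (diag_mx e)) ^+ 2 =
  \sum_i \sum_j esq_mx (abs_mx A) i j * d 0 i ^+ 2 * e 0 j ^+ 2.
Proof.
rewrite frobenius_sqr; apply: eq_bigr => i _; apply: eq_bigr => j _.
rewrite !cplx_diag_mx mul_mx_diag mul_diag_mx !mxE.
rewrite !ComplexField.Normc.normcM !normc_real !exprMn !real_normK ?num_real //.
by ring.
Qed.

Lemma qform_block m n (a b : R) (M : 'M[R]_(m, n)) (x : 'rV_m) (y : 'rV_n) :
  qform (block_mx (a *: (ones m *m (ones m)^T)) M
                  M^T (b *: (ones n *m (ones n)^T))) (row_mx x y) =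
  a * (\sum_i x 0 i) ^+ 2 + 2 * (\sum_i \sum_j M i j * x 0 i * y 0 j)
  + b * (\sum_j y 0 j) ^+ 2.
Proof.
have sqE k (c : R) (z : 'rV[R]_k) :
    \sum_i \sum_j (c *: (ones k *m (ones k)^T)) i j * z 0 i * z 0 j =
    c * (\sum_i z 0 i) ^+ 2.
  rewrite expr2 mulr_suml mulr_sumr; apply: eq_bigr => i _.
  rewrite !mulr_sumr; apply: eq_bigr => j _.
  by rewrite !mxE big_ord1 !mxE; ring.
rewrite /qform big_split_ord /=.
under eq_bigr => i _ do rewrite big_split_ord /=.
under [X in _ + X]eq_bigr => i _ do rewrite big_split_ord /=.
rewrite !big_split /= -!sqE.
have -> : \sum_i \sum_j
    block_mx (a *: (ones m *m (ones m)^T)) M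
                  M^T (b *: (ones n *m (ones n)^T)) (rshift m i) (lshift n j) *
    row_mx x y 0 (rshift m i) * row_mx x y 0 (lshift n j)
   = \sum_i \sum_j M i j * x 0 i * y 0 j.
  rewrite exchange_big; apply: eq_bigr => i _; apply: eq_bigr => j _.
  by rewrite block_mxEdl row_mxEl row_mxEr mxE mulrAC.
rewrite -!addrA; congr (_ + _).
  apply: eq_bigr => i _; apply: eq_bigr => j _.
  by rewrite block_mxEul !row_mxEl.
rewrite mulr_natl mulr2n -addrA; congr (_ + (_ + _)).
  apply: eq_bigr => i _; apply: eq_bigr => j _.
  by rewrite block_mxEur row_mxEl row_mxEr.
apply: eq_bigr => i _; apply: eq_bigr => j _.
by rewrite block_mxEdr !row_mxEr.
Qed.

Lemma ones_quad k l (X : 'M[R]_(k, l)) :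
  ((ones k)^T *m X *m ones l) 0 0 = \sum_i \sum_j X i j.
Proof.
rewrite mxE exchange_big; apply: eq_bigr => j _.
rewrite !mxE mulr1; apply: eq_bigr => i _.
by rewrite !mxE mul1r.
Qed.

Lemma qform_sum k (N : 'M[R]_k) (x : 'rV[R]_k) :
  qform N x = \sum_i \sum_j (diag_mx x *m N *m diag_mx x) i j.
Proof.
apply: eq_bigr => i _; apply: eq_bigr => j _.
by rewrite mul_mx_diag mul_diag_mx !mxE [_ * N i j]mulrC.
Qed.

Section Problems.
Variables (m n : nat) (A B : 'M[R[i]]_(m, n)) (alpha c : R).

Lemma sqdiag_diag_mx (d : 'rV[R]_m) (e : 'rV[R]_n) :
  sqdiag (diag_mx d, diag_mx e) =
  row_mx (\row_i d 0 i ^+ 2) (\row_j e 0 j ^+ 2).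
Proof.
by congr row_mx; apply/rowP => i; rewrite !mxE eqxx mulr1n.
Qed.

Lemma scaling_objectiveE (d : 'rV[R]_m) (e : 'rV[R]_n) :
  objective (scaling_problem A B alpha c) (diag_mx d, diag_mx e) =
  qform (Malpha_sq A B alpha) (sqdiag (diag_mx d, diag_mx e)).
Proof.
rewrite sqdiag_diag_mx qform_block /= !frobenius_scale_sqr.
rewrite -![_ ^+ 4]/(_ ^+ (2 * 2)) !exprM !frobenius_diag_sqr -big_split /=.
have -> : \sum_i (\sum_j esq_mx (abs_mx A) i j * d 0 i ^+ 2 * e 0 j ^+ 2 +
    \sum_j esq_mx (abs_mx B) i j * d 0 i ^+ 2 * e 0 j ^+ 2) =
    \sum_i \sum_j sum_abs_sq A B i j * (\row_i d 0 i ^+ 2) 0 i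
      * (\row_j e 0 j ^+ 2) 0 j.
  apply: eq_bigr => i _; rewrite -big_split; apply: eq_bigr => j _.
  by rewrite !mxE /=; ring.
under [in RHS]eq_bigr do rewrite mxE.
under [X in _ + _ * X ^+ _]eq_bigr do rewrite mxE.
ring.
Qed.

Lemma entry_sum_objectiveE (d : 'rV[R]_m) (e : 'rV[R]_n) :
  objective (entry_sum_problem A B alpha c) (diag_mx d, diag_mx e) =
  qform (Malpha_sq A B alpha) (sqdiag (diag_mx d, diag_mx e)).
Proof.
rewrite /= ones_quad qform_sum sqdiag_diag_mx diag_mx_row -!diag_mx_sqr.
rewrite !mulmx_block !mul0mx !mulmx0 !addr0 !add0r.
by rewrite -!scalemxAr -!scalemxAl !mulmxA.
Qed.

Lemma frobenius_objectiveE (Malpha : 'M[R]_(m + n))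
    (MalphaE : esq_mx Malpha = Malpha_sq A B alpha)
    (d : 'rV[R]_m) (e : 'rV[R]_n) :
  objective (frobenius_problem Malpha c) (diag_mx d, diag_mx e) =
  qform (Malpha_sq A B alpha) (sqdiag (diag_mx d, diag_mx e)).
Proof.
rewrite /= frobenius_cplx_sqr qform_sum sqdiag_diag_mx -diag_mx_row -MalphaE.
set v := row_mx d e.
have -> : row_mx (\row_i d 0 i ^+ 2) (\row_j e 0 j ^+ 2) = \row_i v 0 i ^+ 2.
  apply/rowP => i; rewrite !mxE.
  by case: splitP => j _; rewrite mxE.
apply: eq_bigr => i _; apply: eq_bigr => j _.
by rewrite !mul_mx_diag !mul_diag_mx !mxE !exprMn.
Qed.

(** It is enough to compare objectives on pairs of diagonal matrices, which
    are all that the constraint set contains. *)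
Lemma equivalent_scaling (f : minimization R ('M[R]_m * 'M[R]_n)) :
  feasible f = scaling_set c ->
  (forall d e, objective f (diag_mx d, diag_mx e) =
     qform (Malpha_sq A B alpha) (sqdiag (diag_mx d, diag_mx e))) ->
  equivalent (scaling_problem A B alpha c) f.
Proof.
move=> fE fobj; split=> [|[D1 D2] [pD1 pD2 _]]; first by rewrite fE.
have /= D1E := posdiag_diag_mx pD1; have /= D2E := posdiag_diag_mx pD2.
by rewrite D1E D2E fobj; exact: scaling_objectiveE.
Qed.

(** Square roots of a positive vector of product [c] give a feasible pair:
    [sqdiag] is onto, and [sqdiag_inj] makes it a bijection. *)
Lemma scaling_setP (x : 'rV[R]_(m + n)) :
  (forall i, 0 < x 0 i) -> \prod_i x 0 i = c ->
  exists2 D, scaling_set c D & sqdiag D = x.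
Proof.
move=> x_gt0 xc.
exists (diag_mx (map_mx Num.sqrt (lsubmx x)), diag_mx (map_mx Num.sqrt (rsubmx x))).
  split=> /=; try by apply: posdiag_diag_row => i; rewrite !mxE sqrtr_gt0.
  rewrite !diag_mx_sqr !det_diag -xc big_split_ord /=.
  by congr (_ * _); apply: eq_bigr => i _; rewrite !mxE sqr_sqrtr // ltW.
rewrite sqdiag_diag_mx -[RHS]hsubmxK.
by congr row_mx; apply/rowP => i; rewrite !mxE sqr_sqrtr // ltW.
Qed.

Lemma sqdiag_gt0 (D : 'M[R]_m * 'M[R]_n) : scaling_set c D ->
  forall i, 0 < sqdiag D 0 i.
Proof.
case=> -[_ D1] [_ D2] _ i; rewrite mxE.
by case: splitP => j _; rewrite mxE exprn_gt0.
Qed.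

Lemma sqdiag_prod (D : 'M[R]_m * 'M[R]_n) : scaling_set c D ->
  \prod_i sqdiag D 0 i = c.
Proof.
case: D => D1 D2 [/= /posdiag_diag_mx D1E /posdiag_diag_mx D2E].
rewrite {1}D1E {1}D2E !diag_mx_sqr !det_diag => <-; rewrite big_split_ord /=.
by congr (_ * _); apply: eq_bigr => i _; rewrite ?row_mxEl ?row_mxEr !mxE.
Qed.

Lemma sqdiag_inj (D E : 'M[R]_m * 'M[R]_n) :
  scaling_set c D -> scaling_set c E -> sqdiag D = sqdiag E -> D = E.
Proof.
case: D E => [D1 D2] [E1 E2] [/= dD1 dD2 _] [/= dE1 dE2 _] /eq_row_mx[/rowP e1 /rowP e2].
have sqI k (X Y : 'M[R]_k) : posdiag X -> posdiag Y ->
    (forall i, X i i ^+ 2 = Y i i ^+ 2) -> X = Y.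
  move=> dX dY XY; rewrite (posdiag_diag_mx dX) (posdiag_diag_mx dY).
  congr diag_mx; apply/rowP => i; rewrite !mxE.
  by apply/eqP; rewrite -(@eqrXn2 _ 2) ?XY // ltW ?(dX.2, dY.2).
by congr (_, _); apply: sqI => // i; [have := e1 i | have := e2 i]; rewrite !mxE.
Qed.

Lemma sqdiag_block (D : 'M[R]_m * 'M[R]_n) : scaling_set c D ->
  block_mx (D.1 ^+ 2) 0 0 (D.2 ^+ 2) = diag_mx (sqdiag D).
Proof.
case: D => D1 D2 [/= /posdiag_diag_mx -> /posdiag_diag_mx -> _].
by rewrite sqdiag_diag_mx diag_mx_row -!diag_mx_sqr.
Qed.

End Problems.
End Objectives.

(** * Minimizing a quadratic form under a product constraint *)

Section Minimizer.
Variables (R : realType) (k : nat) (N : 'M[R]_k).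
Hypothesis N_sym : forall i j, N i j = N j i.
Hypothesis N_ge0 : forall i j, 0 <= N i j.
Hypothesis N_diag : forall i, 0 < N i i.

Implicit Types x y : 'rV[R]_k.

(** Write [y_i = x_i exp u_i]; the entries of [u] add up to [0].  By the
    inequality [exp v >= 1 + v], the difference of the two values is at least
    the sum of [N_ij x_i x_j (u_i + u_j)], which is [2 a] times the sum of the
    [u_i], that is [0].  The diagonal terms make the inequality strict, since
    [exp v > 1 + v] at [v = 2 u_i] as soon as [u_i] is nonzero. *)
Lemma balanced_lt_qform (x y : 'rV[R]_k) (a : R) :
  (forall i, 0 < x 0 i) -> (forall i, 0 < y 0 i) ->
  (forall i, x 0 i * (\sum_j N i j * x 0 j) = a) ->
  \prod_i x 0 i = \prod_i y 0 i ->
  y != x -> qform N x < qform N y.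
Proof.
move=> x_gt0 y_gt0 bal xy yx.
pose u i := ln (y 0 i / x 0 i).
have yE i : y 0 i = x 0 i * expR (u i).
  by rewrite lnK ?posrE ?divr_gt0 // mulrCA divff ?mulr1 ?gt_eqF.
have u0 : \sum_i u i = 0.
  apply: expR_inj; rewrite expR0 expR_sum.
  apply: (mulfI (x := \prod_i x 0 i)); first by rewrite gt_eqF // prodr_gt0.
  rewrite mulr1 [RHS]xy; under [RHS]eq_bigr => i _ do rewrite yE.
  by rewrite big_split.
have [i ui] : exists i, u i != 0.
  apply/existsP; apply: contraNT yx; rewrite negb_exists => /forallP un.
  apply/eqP/rowP => i; rewrite yE; have := un i; rewrite negbK => /eqP ->.
  by rewrite expR0 mulr1.
pose g i j := N i j * x 0 i * x 0 j * (expR (u i + u j) - (1 + (u i + u j))).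
have g_ge0 i' j : 0 <= g i' j.
  by rewrite /g mulr_ge0 ?mulr_ge0 ?(ltW (x_gt0 _)) // subr_ge0 expR_ge1Dx.
have lin : \sum_i \sum_j N i j * x 0 i * x 0 j * (u i + u j) = 0.
  transitivity (\sum_i a * u i + \sum_j a * u j).
    under eq_bigr => i' _ do under eq_bigr => j _ do rewrite mulrDr.
    under eq_bigr => i' _ do rewrite big_split /=.
    rewrite big_split /=; congr (_ + _).
      apply: eq_bigr => i' _; rewrite -mulr_suml -(bal i').
      by rewrite mulr_sumr; congr (_ * _); apply: eq_bigr => j _; ring.
    rewrite exchange_big; apply: eq_bigr => j _; rewrite -mulr_suml -(bal j).
    rewrite mulr_sumr; congr (_ * _); apply: eq_bigr => i' _.
    by rewrite (N_sym i' j); ring.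
  by rewrite -mulr_sumr u0 mulr0 addr0.
have -> : qform N y = qform N x + \sum_i \sum_j g i j.
  rewrite -[LHS]subr0 -[X in _ - X]lin /qform -sumrB -big_split /=.
  apply: eq_bigr => i' _ /=.
  rewrite -sumrB -big_split; apply: eq_bigr => j _ /=.
  by rewrite /g !yE expRD; ring.
rewrite ltrDl (bigD1 i) //= ltr_pwDl //.
  rewrite (bigD1 i) //= ltr_pwDl ?sumr_ge0 // /g mulr_gt0 //.
    by rewrite !mulr_gt0.
  rewrite subr_gt0 expR_gt1Dx // -mulr2n mulrn_eq0 negb_or /=; exact: ui.
by rewrite sumr_ge0 // => i' _; rewrite sumr_ge0.
Qed.

Lemma qformD x h :
  qform N (x + h) = qform N x
    + 2 * (\sum_i h 0 i * (\sum_j N i j * x 0 j))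
    + \sum_i h 0 i * (\sum_j N i j * h 0 j).
Proof.
have -> : 2 * (\sum_i h 0 i * (\sum_j N i j * x 0 j)) =
    \sum_i \sum_j (h 0 i * (N i j * x 0 j) + x 0 i * (N i j * h 0 j)).
  under [RHS]eq_bigr do rewrite big_split /=.
  rewrite big_split /= mulr_natl mulr2n; congr (_ + _).
    by apply: eq_bigr => i _; rewrite mulr_sumr.
  rewrite exchange_big; apply: eq_bigr => i _; rewrite mulr_sumr.
  by apply: eq_bigr => j _; rewrite (N_sym i j); ring.
rewrite /qform -!big_split; apply: eq_bigr => i _ /=.
rewrite mulr_sumr -!big_split; apply: eq_bigr => j _ /=.
by rewrite !mxE; ring.
Qed.

(** Otherwise let [i] have a larger value [r_i = x_i (N x)_i] than [j], and
    replace [x_i] by [s x_i] and [x_j] by [x_j / s] with [s = 1 - t].  The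
    product is unchanged, and the form changes by [2 t (r_j - r_i)] up to terms
    of order [t ^+ 2], a decrease when [t] is small. *)
Lemma minimizer_balanced x :
  (forall i, 0 < x 0 i) ->
  (forall y, (forall i, 0 < y 0 i) -> \prod_i y 0 i = \prod_i x 0 i ->
     qform N x <= qform N y) ->
  forall i j, x 0 i * (\sum_l N i l * x 0 l) <= x 0 j * (\sum_l N j l * x 0 l).
Proof.
move=> x_gt0 xmin i j; have [<-//|ij] := eqVneq i j.
pose r i := x 0 i * (\sum_l N i l * x 0 l).
rewrite -![_ * \sum_l _]/(r _) leNgt; apply/negP => rji.
pose d := r i - r j; have d_gt0 : 0 < d by rewrite subr_gt0.
have r_gt0 l : 0 < r l.
  rewrite mulr_gt0 // (bigD1 l) //= ltr_pwDl ?mulr_gt0 // sumr_ge0 // => l' _.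
  by rewrite mulr_ge0 // ltW.
pose al := N i i * x 0 i ^+ 2; pose be := N j j * x 0 j ^+ 2.
have al_gt0 : 0 < al by rewrite mulr_gt0 ?exprn_gt0.
have be_gt0 : 0 < be by rewrite mulr_gt0 ?exprn_gt0.
pose K := al + be + r i.
have K_gt0 : 0 < K by rewrite !addr_gt0.
(* This [t] satisfies both [t <= 1 / 2], which keeps [s] away from 0, and
   [t * K < d], where [K] bounds all the second-order terms. *)
pose t := d / (2 * (d + K)).
have dK_gt0 : 0 < 2 * (d + K) by rewrite mulr_gt0 // addr_gt0.
have t_gt0 : 0 < t by rewrite divr_gt0.
have t_le : t <= 1 / 2.
  by rewrite ler_pdivrMr //; lra.
have tK : t * K < d.
  by rewrite mulrAC ltr_pdivrMr // ltr_pM2l //; lra.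
pose s := 1 - t.
have s_gt0 : 0 < s by rewrite /s; lra.
pose h : 'rV[R]_k := \row_l
  (if l == i then - t * x 0 i else if l == j then t / s * x 0 j else 0).
have hi : h 0 i = - t * x 0 i by rewrite mxE eqxx.
have hj : h 0 j = t / s * x 0 j by rewrite mxE eq_sym (negPf ij) eqxx.
have hsum (f : 'I_k -> R) : \sum_l h 0 l * f l = h 0 i * f i + h 0 j * f j.
  rewrite (bigD1 i) //= (bigD1 j) /= 1?eq_sym // big1 ?addr0 // => l.
  by case/andP=> li lj; rewrite mxE (negPf li) (negPf lj) mul0r.
have yi : (x + h) 0 i = x 0 i * s by rewrite mxE hi /s; ring.
have yj : (x + h) 0 j = x 0 j * s^-1.
  by rewrite mxE hj /s; field; rewrite gt_eqF.
have yl l : l != i -> l != j -> (x + h) 0 l = x 0 l.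
  by move=> li lj; rewrite !mxE (negPf li) (negPf lj) addr0.
have y_gt0 l : 0 < (x + h) 0 l.
  have [->|li] := eqVneq l i; first by rewrite yi mulr_gt0.
  have [->|lj] := eqVneq l j; first by rewrite yj mulr_gt0 ?invr_gt0.
  by rewrite yl.
have y_prod : \prod_l (x + h) 0 l = \prod_l x 0 l.
  rewrite (bigD1 i) //= (bigD1 j) /= 1?eq_sym // yi yj.
  rewrite [RHS](bigD1 i) //= [in RHS](bigD1 j) /= 1?eq_sym //.
  have -> : \prod_(l < k | (l != i) && (l != j)) (x + h) 0 l =
            \prod_(l < k | (l != i) && (l != j)) x 0 l.
    by apply: eq_bigr => l /andP[li lj]; rewrite yl.
  by field; rewrite gt_eqF.
have := xmin _ y_gt0 y_prod; rewrite qformD -addrA lerDl !hsum.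
have nsumE l : \sum_l' N l l' * h 0 l' = h 0 i * N l i + h 0 j * N l j.
  by rewrite -hsum; apply: eq_bigr => l' _; rewrite mulrC.
rewrite !nsumE hi hj (N_sym j i).
pose p := N i j * x 0 i * x 0 j.
have p_ge0 : 0 <= p by rewrite mulr_ge0 ?mulr_ge0 // ltW.
set E := (X in 0 <= X).
have -> : E = t / s ^+ 2 *
    (t * (al * s ^+ 2 - 2 * s * p + be) - 2 * s * (s * r i - r j)).
  by rewrite /E /al /be /r /p; field; rewrite gt_eqF.
rewrite pmulr_rge0 ?divr_gt0 ?exprn_gt0 //; apply/negP; rewrite -ltNge.
have tri : t * r i < d.
  by apply: le_lt_trans tK; rewrite ler_pM2l // /K; lra.
have -> : s * r i - r j = d - t * r i by rewrite /s /d; ring.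
have s_half : 1 <= 2 * s by rewrite /s; lra.
have s_le1 : s ^+ 2 <= 1 by rewrite expr_le1 // /s; lra.
have le1 : t * (al * s ^+ 2 - 2 * s * p + be) <= t * (al + be).
  have sp_ge0 : 0 <= 2 * s * p by rewrite !mulr_ge0 // ltW.
  have als : al * s ^+ 2 <= al by rewrite ler_piMr // ltW.
  by rewrite ler_pM2l //; lra.
have le2 : d - t * r i <= 2 * s * (d - t * r i).
  by rewrite ler_peMl // subr_ge0 ltW.
rewrite subr_lt0 (le_lt_trans le1) // (lt_le_trans _ le2) //.
by rewrite ltrBrDr -mulrDr.
Qed.

(** The diagonal terms [N_ii y_i ^+ 2] bound each entry from above; the
    product constraint then bounds each entry from below. *)
Lemma qform_sublevel_bounded (c F : R) : 0 < c ->
  exists ab : R * R, 0 < ab.1 /\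
    forall y, (forall i, 0 < y 0 i) -> \prod_i y 0 i = c -> qform N y <= F ->
    forall i, ab.1 <= y 0 i <= ab.2.
Proof.
move=> c_gt0; pose C := 1 + \sum_i `|F| / N i i.
have C_ge1 : 1 <= C.
  by rewrite lerDl sumr_ge0 // => i _; rewrite divr_ge0 // ltW.
have C_gt0 : 0 < C by rewrite (lt_le_trans _ C_ge1).
exists (c / C ^+ k, C); split=> [|y y_gt0 yc yF]; first by rewrite divr_gt0 ?exprn_gt0.
have yC i : y 0 i <= C.
  have yi2 : N i i * y 0 i ^+ 2 <= `|F|.
    rewrite (le_trans _ (ler_norm _)) // (le_trans _ yF) //.
    rewrite /qform (bigD1 i) //= (bigD1 i) //= expr2 mulrA -addrA lerDl.
    rewrite addr_ge0 ?sumr_ge0 // => [j _|j _]; rewrite ?sumr_ge0 // => *;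
    by rewrite ?mulr_ge0 // ltW.
  have : y 0 i ^+ 2 <= C.
    rewrite (@le_trans _ _ (`|F| / N i i)) //.
      by rewrite ler_pdivlMr // mulrC.
    rewrite /C (bigD1 i) //= addrCA lerDl addr_ge0 // sumr_ge0 // => j _.
    by rewrite divr_ge0 // ltW.
  move=> y2C; have : y 0 i ^+ 2 <= C ^+ 2.
    by rewrite (le_trans y2C) // expr2 ler_peMl // ltW.
  by rewrite ler_sqr // nnegrE ltW.
move=> i /=; rewrite yC andbT ler_pdivrMr ?exprn_gt0 //.
rewrite -yc (bigD1 i) //= ler_pM2l //.
apply: (@le_trans _ _ (\prod_(j < k | j != i) C)).
  by apply: ler_prod => j _; rewrite ltW //= yC.
by rewrite prodr_const ler_weXn2l // -[leqRHS]card_ord max_card.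
Qed.

Lemma qform_continuous : continuous (qform N).
Proof.
move=> x; apply: (@cvg_sumr R _ (nbhs x)) => i.
apply: (@cvg_sumr R _ (nbhs x)) => j.
apply: cvgM; last exact: coord_continuous.
by apply: cvgM; [exact: cvg_cst | exact: coord_continuous].
Qed.

Lemma prod_coord_continuous :
  continuous (fun x : 'rV[R]_k => \prod_i x 0 i).
Proof.
move=> x; apply: (@cvg_prodr R _ (nbhs x)) => i.
exact: coord_continuous.
Qed.

(** Any feasible point [x0] confines the minimization to the compact set of
    feasible points in the box of [qform_sublevel_bounded]. *)
Lemma exists_qform_minimizer (c : R) : (0 < k)%N -> 0 < c ->
  exists x, [/\ forall i, 0 < x 0 i, \prod_i x 0 i = c &
    forall y, (forall i, 0 < y 0 i) -> \prod_i y 0 i = c ->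
      qform N x <= qform N y].
Proof.
move=> k_gt0 c_gt0; pose i0 := Ordinal k_gt0.
pose x0 : 'rV[R]_k := \row_i (if i == i0 then c else 1).
have x0_gt0 i : 0 < x0 0 i by rewrite mxE; case: ifP.
have x0_prod : \prod_i x0 0 i = c.
  rewrite (bigD1 i0) //= mxE eqxx big1 ?mulr1 // => i /negPf ni.
  by rewrite mxE ni.
have [[a b] /= [a_gt0 ab]] := qform_sublevel_bounded (qform N x0) c_gt0.
pose K := ([set x : 'rV[R]_k | forall i, `[a, b]%classic (x 0 i)]
  `&` [set x | \prod_i x 0 i = c])%classic.
have K_x0 : K x0 by split=> //= i; rewrite in_itv /= ab.
have K_compact : compact K.
  apply: compact_closedI.
    by apply: (@rV_compact _ _ (fun=> `[a, b]%classic)) => i; exact: segment_compact.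
  apply: (@closed_comp _ _ (fun x : 'rV[R]_k => \prod_i x 0 i) [set c]%classic).
    by move=> x _; exact: prod_coord_continuous.
  exact: closed_eq.
have [||x Kx xmin] := @EVT_min_rV _ _ (qform N) K _ K_compact.
- by exists x0.
- by apply: continuous_subspaceT; exact: qform_continuous.
rewrite inE in Kx; case: Kx => /= x_ab xc; exists x; split=> // [i|y y_gt0 yc].
  by have := x_ab i; rewrite in_itv /= => /andP[+ _]; exact: lt_le_trans.
have [yF|/ltW yF] := leP (qform N y) (qform N x0).
  by apply: xmin; rewrite inE; split=> //= i; rewrite in_itv /= ab.
by apply: le_trans yF; apply: xmin; rewrite inE.
Qed.

Lemma exists_balanced (c : R) : (0 < k)%N -> 0 < c ->
  exists x a, [/\ forall i, 0 < x 0 i, \prod_i x 0 i = c, 0 < a &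
    forall i, x 0 i * (\sum_j N i j * x 0 j) = a].
Proof.
move=> k_gt0 c_gt0; pose i0 := Ordinal k_gt0.
have [x [x_gt0 xc xmin]] := exists_qform_minimizer k_gt0 c_gt0.
exists x, (x 0 i0 * (\sum_j N i0 j * x 0 j)); split=> // [|i].
  rewrite mulr_gt0 // (bigD1 i0) //= ltr_pwDl ?mulr_gt0 // sumr_ge0 // => j _.
  by rewrite mulr_ge0 // ltW.
by apply/eqP; rewrite eq_le !minimizer_balanced // => y; rewrite xc; exact: xmin.
Qed.

End Minimizer.

(** * Contraction of alternating reciprocal averages *)

(** A half pass of the Sinkhorn-Knopp iteration on a symmetric doubly
    stochastic [P] turns the scalings of one side into those of the other by
    this map. *)
Definition recip_avg (R : realType) k (P : 'M[R]_k) (z : 'cV[R]_k) : 'cV[R]_k :=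
  \col_i ((P *m z) i 0)^-1.

Section Contraction.
Local Open Scope classical_set_scope.
Local Open Scope ring_scope.
Variables (R : realType) (k : nat) (P : 'M[R]_k).
Hypothesis P_ge0 : forall i j, 0 <= P i j.
Hypothesis P_row : forall i, \sum_j P i j = 1.

Implicit Types (z f : 'cV[R]_k) (a b : R).

Let T := recip_avg P.
Let T2 z := T (T z).

Lemma avg_le z f : (forall i, z i 0 <= f i 0) -> forall i, (P *m z) i 0 <= (P *m f) i 0.
Proof. by move=> zf i; rewrite !mxE ler_sum // => j _; rewrite ler_wpM2l. Qed.

Lemma avg_const a i : (P *m const_mx a : 'cV_k) i 0 = a.
Proof.
by rewrite mxE; under eq_bigr do rewrite mxE; rewrite -mulr_suml P_row mul1r.
Qed.

Lemma avg_ge a z : (forall i, a <= z i 0) -> forall i, a <= (P *m z) i 0.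
Proof.
by move=> az i; rewrite -[leLHS](avg_const a i) avg_le // => j; rewrite mxE.
Qed.

Lemma avg_le_ub b z : (forall i, z i 0 <= b) -> forall i, (P *m z) i 0 <= b.
Proof.
by move=> zb i; rewrite -[leRHS](avg_const b i) avg_le // => j; rewrite mxE.
Qed.

Lemma recip_avgE z i : T z i 0 = ((P *m z) i 0)^-1.
Proof. by rewrite mxE. Qed.

Lemma recip_avg_le a z : 0 < a -> (forall i, a <= z i 0) ->
  forall i, T z i 0 <= a^-1.
Proof.
move=> a_gt0 az i; rewrite mxE lef_pV2 ?posrE ?avg_ge //.
by rewrite (lt_le_trans a_gt0) // avg_ge.
Qed.

Lemma recip_avg_ge a b z : 0 < a -> (forall i, a <= z i 0 <= b) ->
  forall i, b^-1 <= T z i 0.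
Proof.
move=> a_gt0 ab i.
have Pz_gt0 : 0 < (P *m z) i 0.
  by rewrite (lt_le_trans a_gt0) // avg_ge // => j; case/andP: (ab j).
have Pzb : (P *m z) i 0 <= b by apply: avg_le_ub => j; case/andP: (ab j).
by rewrite mxE lef_pV2 ?posrE // (lt_le_trans Pz_gt0).
Qed.

Lemma recip_avg2_bounds a b z : 0 < a -> (forall i, a <= z i 0 <= b) ->
  forall i, a <= T2 z i 0 <= b.
Proof.
move=> a_gt0 ab i.
have b_gt0 : 0 < b.
  by case/andP: (ab i) => az zb; apply: lt_le_trans a_gt0 (le_trans az zb).
have bd j : b^-1 <= T z j 0 <= a^-1.
  rewrite (recip_avg_ge a_gt0) // recip_avg_le // => l.
  by case/andP: (ab l).
have b'_gt0 : 0 < b^-1 by rewrite invr_gt0.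
apply/andP; split; first by have := recip_avg_ge b'_gt0 bd i; rewrite invrK.
have Tz_ge j : b^-1 <= T z j 0 by case/andP: (bd j).
by have := recip_avg_le b'_gt0 Tz_ge i; rewrite invrK.
Qed.

(** Any deficit [th f] of [z] below the upper bound [b] is spread by the two
    averages.  The first inverse turns the deficit [x = th (P f)_i] into an
    excess over [b^-1] by [1 / (1 - x) >= 1 + x], and the second turns the excess
    [x = th (P (P f))_i] back into a deficit by [1 / (1 + x) <= 1 - x / 2], which
    costs the factor [2]. *)
Lemma recip_avg2_gain a b th z f : 0 < a -> 0 <= th <= 1 ->
  (forall i, 0 <= f i 0 <= 1) -> (forall i, a <= z i 0) ->
  (forall i, z i 0 <= b * (1 - th * f i 0)) ->
  forall i, T2 z i 0 <= b * (1 - th / 2 * (P *m (P *m f)) i 0).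
Proof.
move=> a_gt0 /andP[th_ge0 th_le1] f01 az zb i.
have f_ge0 j : 0 <= f j 0 by case/andP: (f01 j).
have f_le1 j : f j 0 <= 1 by case/andP: (f01 j).
have Pf_ge0 := avg_ge f_ge0; have PPf_ge0 := avg_ge Pf_ge0.
have PPf_le1 := avg_le_ub (avg_le_ub f_le1).
have b_gt0 : 0 < b.
  rewrite ltNge; apply/negP => b_le0.
  have := lt_le_trans a_gt0 (le_trans (az i) (zb i)).
  by rewrite ltNge mulr_le0_ge0 // subr_ge0 mulr_ile1.
have affine (r s : R) (g : 'cV[R]_k) j :
    (P *m (r *: (const_mx 1 + s *: g))) j 0 = r * (1 + s * (P *m g) j 0).
  rewrite -scalemxAr [LHS]mxE mulmxDr [X in _ * X]mxE avg_const.
  by rewrite -scalemxAr [X in _ + X]mxE.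
have Pz j : (P *m z) j 0 <= b * (1 - th * (P *m f) j 0).
  have -> : b * (1 - th * (P *m f) j 0) =
      (P *m (b *: (const_mx 1 + (- th) *: f))) j 0.
    by rewrite affine mulNr.
  by apply: avg_le => l; rewrite !mxE mulNr.
have Tz j : b^-1 * (1 + th * (P *m f) j 0) <= T z j 0.
  have Pz_gt0 : 0 < (P *m z) j 0 by rewrite (lt_le_trans a_gt0) // avg_ge.
  rewrite recip_avgE -[leRHS]mul1r ler_pdivlMr // -mulrA ler_pdivrMl // mulr1.
  apply: le_trans (ler_wpM2l _ (Pz j)) _; first by rewrite addr_ge0 // mulr_ge0.
  rewrite mulrCA; apply: ler_piMr; first exact: ltW.
  rewrite -subr_ge0.
  have -> : 1 - (1 + th * (P *m f) j 0) * (1 - th * (P *m f) j 0) =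
            (th * (P *m f) j 0) ^+ 2 by ring.
  exact: sqr_ge0.
have PTz : b^-1 * (1 + th * (P *m (P *m f)) i 0) <= (P *m T z) i 0.
  have -> : b^-1 * (1 + th * (P *m (P *m f)) i 0) =
      (P *m (b^-1 *: (const_mx 1 + th *: (P *m f)))) i 0.
    by rewrite affine.
  apply: avg_le => l; apply: le_trans (Tz l).
  by rewrite [leLHS]mxE [X in _ * X]mxE [X in _ * (X + _)]mxE [X in _ * (_ + X)]mxE.
set x := th * (P *m (P *m f)) i 0 in PTz *.
have x_ge0 : 0 <= x by rewrite mulr_ge0.
have x_le1 : x <= 1 by rewrite mulr_ile1.
have x1_gt0 : 0 < 1 + x by rewrite ltr_pwDl.
rewrite /T2 recip_avgE -[leLHS]mul1r ler_pdivrMr; last first.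
  by apply: lt_le_trans PTz; rewrite mulr_gt0 ?invr_gt0.
have -> : th / 2 * (P *m (P *m f)) i 0 = x / 2 by rewrite /x; ring.
have x2_ge0 : 0 <= b * (1 - x / 2) by rewrite mulr_ge0 ?ltW //; lra.
apply: le_trans (ler_wpM2l x2_ge0 PTz).
have -> : b * (1 - x / 2) * (b^-1 * (1 + x)) = 1 + x * (1 - x) / 2.
  by field; rewrite gt_eqF.
by rewrite lerDl divr_ge0 // mulr_ge0 // subr_ge0.
Qed.

Lemma iter_recip_avg2_bounds a b z n : 0 < a -> (forall i, a <= z i 0 <= b) ->
  forall i, a <= iter n T2 z i 0 <= b.
Proof.
by move=> a_gt0 zab; elim: n => //= n IH i; apply: recip_avg2_bounds.
Qed.

Lemma iter_recip_avg2_gain h a b th z f : 0 < a -> 0 <= th <= 1 ->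
  (forall i, 0 <= f i 0 <= 1) -> (forall i, a <= z i 0 <= b) ->
  (forall i, z i 0 <= b * (1 - th * f i 0)) ->
  forall i, iter h T2 z i 0 <= b * (1 - th / 2 ^+ h * (P ^+ (2 * h) *m f) i 0).
Proof.
move=> a_gt0; elim: h th z f => [|h IH] th z f th01 f01 zab zb i.
  by rewrite /= muln0 !expr0 divr1 -[1 *m _]/(1%:M *m _) mul1mx.
rewrite iterSr; apply: le_trans (IH (th / 2) _ (P *m (P *m f)) _ _ _ _ i) _.
- by case/andP: th01 => *; apply/andP; split; lra.
- have f_ge0 j : 0 <= f j 0 by case/andP: (f01 j).
  have f_le1 j : f j 0 <= 1 by case/andP: (f01 j).
  by move=> j; apply/andP; split; [do 2 apply: avg_ge | do 2 apply: avg_le_ub].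
- exact: recip_avg2_bounds.
- by apply: (recip_avg2_gain a_gt0) => // j; case/andP: (zab j).
rewrite mulnS [(2 + _)%N]addnC exprD -[P ^+ _ * P ^+ 2]/(P ^+ _ *m (P *m P)).
by rewrite !mulmxA exprS invfM mulrA.
Qed.

(** The minimum of the iterates increases and their maximum decreases.
    Applying [iter_recip_avg2_gain] to the indicator of an entry where the
    minimum is attained shows that [h] steps decrease the maximum by a fixed
    proportion of the distance to the minimum, so both have the same limit. *)
Theorem recip_avg2_cvg h z : (0 < k)%N ->
  (forall i j, 0 < (P ^+ (2 * h)) i j) -> (forall i, 0 < z i 0) ->
  exists2 lam : R, 0 < lam & forall i, iter n T2 z i 0 @[n --> \oo] --> lam.
Proof.
move=> k_gt0 Ph z_gt0; pose i0 := Ordinal k_gt0.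
pose lo z := z [arg min_(i < i0) z i 0]%O 0 : R.
pose hi z := z [arg max_(i > i0) z i 0]%O 0 : R.
have loP (y : 'cV[R]_k) i : lo y <= y i 0.
  by rewrite /lo; case: Order.TotalTheory.arg_minP => // j _; apply.
have hiP (y : 'cV[R]_k) i : y i 0 <= hi y.
  by rewrite /hi; case: Order.TotalTheory.arg_maxP => // j _; apply.
have hi_le (y : 'cV[R]_k) b : (forall i, y i 0 <= b) -> hi y <= b by apply.
pose y n := iter n T2 z.
have lo_gt0 n : 0 < lo (y n).
  have zlh i : lo z <= z i 0 <= hi z by rewrite loP hiP.
  pose j := [arg min_(i < i0) y n i 0]%O.
  have [/= + _] := andP (iter_recip_avg2_bounds n (z_gt0 _ : 0 < lo z) zlh j).
  exact: lt_le_trans (z_gt0 _).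
have ylh n i : lo (y n) <= y n i 0 <= hi (y n) by rewrite loP hiP.
have y_step n i : lo (y n) <= y n.+1 i 0 <= hi (y n).
  exact: (recip_avg2_bounds (lo_gt0 n)).
have lo_nd : nondecreasing_seq (fun n => lo (y n)).
  by apply/nondecreasing_seqP => n; case/andP: (y_step n [arg min_(i < i0) y n.+1 i 0]%O).
have hi_ni : nonincreasing_seq (fun n => hi (y n)).
  by apply/nonincreasing_seqP => n; case/andP: (y_step n [arg max_(i > i0) y n.+1 i 0]%O).
have lo_le_hi n : lo (y n) <= hi (y n) by apply: le_trans (loP _ i0) (hiP _ i0).
have lo_cvg : cvgn (fun n => lo (y n)).
  apply: nondecreasing_is_cvgn => //; exists (hi (y 0%N)) => _ [n _ <-].
  by apply: le_trans (lo_le_hi n) _; apply: hi_ni.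
have hi_cvg : cvgn (fun n => hi (y n)).
  apply: nonincreasing_is_cvgn => //; exists (lo (y 0%N)) => _ [n _ <-].
  by apply: le_trans (lo_le_hi n); apply: lo_nd.
pose kap := lo (\col_i lo (\col_j (P ^+ (2 * h)) i j)) / 2 ^+ h.
have kap_gt0 : 0 < kap by rewrite divr_gt0 ?exprn_gt0 // /lo !mxE.
have gain n : hi (y (n + h)%N) <= hi (y n) - kap * (hi (y n) - lo (y n)).
  set a := lo (y n); set b := hi (y n).
  have a_gt0 : 0 < a := lo_gt0 n; have ab : a <= b := lo_le_hi n.
  have b_gt0 : 0 < b := lt_le_trans a_gt0 ab.
  pose j0 := [arg min_(i < i0) y n i 0]%O.
  pose th := 1 - a / b.
  have th01 : 0 <= th <= 1.
    by rewrite subr_ge0 ler_pdivrMr // mul1r ab gerBl divr_ge0 // ltW.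
  (* With this [th], [b * (1 - th)] is the minimum [a] attained at [j0]. *)
  pose f : 'cV[R]_k := delta_mx j0 0.
  rewrite /y addnC iterD -/(y n).
  apply: hi_le => i.
  apply: le_trans (iter_recip_avg2_gain h (f := f) a_gt0 th01 _ (ylh n) _ i) _.
  - by move=> j; rewrite mxE andbT; case: eqP => /=; rewrite ?lexx ?ler01.
  - move=> j; rewrite mxE andbT; have [->|_] /= := eqVneq j j0.
      by rewrite mulr1 /th opprB addrCA subrr addr0 mulrCA divff ?mulr1 ?gt_eqF.
    by rewrite mulr0 subr0 mulr1 hiP.
  rewrite mulrBr mulr1 lerD2l lerN2.
  have -> : (P ^+ (2 * h) *m f) i 0 = (P ^+ (2 * h)) i j0.
    by rewrite -colE mxE.
  have -> : b * (th / 2 ^+ h * (P ^+ (2 * h)) i j0) =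
      (P ^+ (2 * h)) i j0 / 2 ^+ h * (b - a).
    rewrite /th; field; rewrite ?gt_eqF ?exprn_gt0 //=.
  rewrite ler_wpM2r ?subr_ge0 // ler_wpM2r ?invr_ge0 ?exprn_ge0 //.
  have := loP (\col_i lo (\col_j (P ^+ (2 * h)) i j)) i; rewrite [X in _ <= X -> _]mxE.
  move/le_trans; apply.
  by have := loP (\col_j (P ^+ (2 * h)) i j) j0; rewrite [X in _ <= X -> _]mxE.
pose L := limn (fun n => lo (y n)); pose H := limn (fun n => hi (y n)).
have LH : H = L.
  have HL : H <= H - kap * (H - L).
    apply: (@ler_cvg_to _ eventually _ _ (fun n => hi (y (n + h)%N))
      (fun n => hi (y n) - kap * (hi (y n) - lo (y n)))).
    - by move: (hi_cvg : _ --> H); rewrite -(cvg_shiftn h).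
    - by apply: cvgB => //; apply: cvgMl_tmp; exact: cvgB.
    - by near=> n; exact: gain.
  have LH : L <= H.
    by apply: (@ler_cvg_to _ eventually _ _ (fun n => lo (y n))
      (fun n => hi (y n))) => //;
      near=> n.
  apply/eqP; rewrite eq_le LH andbT -subr_le0 -(pmulr_rle0 _ kap_gt0).
  by move: HL; rewrite lerBrDr gerDl.
exists L => [|i].
  by apply: lt_le_trans (lo_gt0 0%N) _; apply: nondecreasing_cvgn_le.
apply: (@squeeze_cvgr _ eventually _ _ (fun n => lo (y n)) (fun n => hi (y n))) => //.
  by near=> n; exact: ylh.
by rewrite -LH.
Unshelve. all: by end_near. Qed.

End Contraction.

(** * The stopped algorithm, given convergence of the iteration *)

Section StoppedAlgorithm.
Local Open Scope classical_set_scope.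
Local Open Scope ring_scope.
Variables (R : realType) (p q : nat) (r : 'rV[R]_p) (c : 'rV[R]_q).

Implicit Types S : sk_state (R := R) (p := p) (q := q).

Definition spread k (v : 'rV[R]_k) : R := `|vmin v / vmax v - 1|.

(** The stopping test compares this single number with the tolerance
    ([sk_stopE]). *)
Definition sk_gap S : R :=
  Num.max (spread (sk_col_factors c S))
          (spread (sk_row_factors r (sk_col_step c S))).

Lemma sk_stopE tol S : sk_stop r c tol S = (sk_gap S <= tol).
Proof. by rewrite /sk_gap ge_max. Qed.

Lemma sk_gap_ge0 S : 0 <= sk_gap S.
Proof. by rewrite /sk_gap le_max normr_ge0. Qed.

Lemma sk_loop_first_stop tol kmax S n : (n < kmax)%N ->
  sk_stop r c tol (iter n (sk_pass r c) S) ->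
  (forall i, (i < n)%N -> ~~ sk_stop r c tol (iter i (sk_pass r c) S)) ->
  sk_loop r c tol kmax S = (true, iter n.+1 (sk_pass r c) S).
Proof.
elim: n kmax S => [|n IH] [|kmax] S //= n_lt stop nstop; first by rewrite stop.
have /negPf -> := nstop 0%N isT.
rewrite (IH kmax) //= -?iterS ?iterSr -?iterSr // => i i_n.
by have := nstop i.+1 i_n; rewrite iterSr.
Qed.

Lemma spread0 k (v : 'rV[R]_k) : spread v = 0 -> forall i, v 0 i = vmax v.
Proof.
move=> /normr0_eq0/eqP; rewrite subr_eq0 => /eqP vv i.
have v0 : vmax v != 0.
  by apply: contra_eq_neq vv => ->; rewrite invr0 mulr0 eq_sym oner_eq0.
have minmax : vmin v = vmax v by rewrite -[LHS](mulfVK v0) vv mul1r.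
apply/eqP; rewrite eq_le; apply/andP; split; first exact: le_bigmax.
by rewrite -minmax; exact: bigmin_le.
Qed.

Hypotheses (r_sum_gt0 : 0 < \sum_i r 0 i) (rc_sum : \sum_i r 0 i = \sum_j c 0 j).
Hypotheses (r_gt0 : forall i, 0 < r 0 i) (c_gt0 : forall j, 0 < c 0 j).

(** Equal updating factors have their common value equal to [1], because the
    entries of the matrix add up to the prescribed total; dividing by them then
    changes nothing. *)
Lemma sk_pass_fixed S : \sum_i \sum_j sk_mx S i j = \sum_j c 0 j ->
  sk_gap S = 0 -> sk_pass r c S = S.
Proof.
move=> tot gap0.
have [gc gr] : spread (sk_col_factors c S) = 0 /\
    spread (sk_row_factors r (sk_col_step c S)) = 0.
  by split; apply/eqP; rewrite -normr_le0 normr_id -gap0 /sk_gap le_max lexx ?orbT.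
have fc1 j : sk_col_factors c S 0 j = 1.
  rewrite (spread0 gc); set v := vmax _.
  have : \sum_j v * c 0 j = \sum_j c 0 j.
    rewrite -tot exchange_big; apply: eq_bigr => l _.
    by rewrite /v -(spread0 gc l) mxE divfK // gt_eqF.
  rewrite -mulr_sumr -[RHS]mul1r => /mulIf -> //.
  by rewrite -rc_sum gt_eqF.
have colS : sk_col_step c S = S.
  case: S {tot gap0 gc gr} fc1 => mx l rr fc1; rewrite /sk_col_step /=.
  by congr SkState; [apply/matrixP => i j | apply/rowP => j];
     rewrite mxE fc1 divr1.
rewrite colS in gr.
have fr1 i : sk_row_factors r S 0 i = 1.
  rewrite (spread0 gr); set v := vmax _.
  have : \sum_i v * r 0 i = \sum_i r 0 i.
    rewrite rc_sum -tot; apply: eq_bigr => l _.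
    by rewrite /v -(spread0 gr l) mxE divfK // gt_eqF.
  rewrite -mulr_sumr -[RHS]mul1r => /mulIf -> //.
  by rewrite gt_eqF.
rewrite /sk_pass colS.
case: S {tot gap0 gc gr fc1 colS} fr1 => mx l rr fr1; rewrite /sk_row_step /=.
by congr SkState; [apply/matrixP => i j | apply/rowP => j];
   rewrite mxE fr1 divr1.
Qed.

Variables (N : 'M[R]_(p, q)) (X : 'M[R]_(p, q)) (l : 'rV[R]_p) (rr : 'rV[R]_q).
Let S n := iter n (sk_pass r c) (sk_init N c).
Hypothesis S_total : forall n, \sum_i \sum_j sk_mx (S n) i j = \sum_j c 0 j.
Hypothesis mx_cvg : forall i j, sk_mx (S n) i j @[n --> \oo] --> X i j.
Hypothesis left_cvg : forall i, sk_left (S n) 0 i @[n --> \oo] --> l 0 i.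
Hypothesis right_cvg : forall j, sk_right (S n) 0 j @[n --> \oo] --> rr 0 j.
Hypotheses (l_max : 0 < vmax l) (rr_max : 0 < vmax rr).
Hypothesis X_row : forall i, \sum_j X i j = r 0 i.
Hypothesis X_col : forall j, \sum_i X i j = c 0 j.

Lemma cvg_spread_const1 k (v : nat -> 'rV[R]_k) : (0 < k)%N ->
  (forall i, v n 0 i @[n --> \oo] --> (1 : R)) ->
  spread (v n) @[n --> \oo] --> (0 : R).
Proof.
move=> k_gt0 v1.
have w1 i : v n 0 i @[n --> \oo] --> (const_mx 1 : 'rV[R]_k) 0 i by rewrite mxE.
have max1 : vmax (const_mx 1 : 'rV[R]_k) = 1.
  apply/eqP; rewrite eq_le; apply/andP; split.
    by apply/bigmax_leP; split=> // i _; rewrite mxE.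
  have := le_bigmax 0 (fun i => (const_mx 1 : 'rV[R]_k) 0 i) (Ordinal k_gt0).
  by rewrite [X in X <= _ -> _]mxE.
have min1 : vmin (const_mx 1 : 'rV[R]_k) = 1.
  rewrite /vmin max1; apply: (big_ind (fun x => x = 1)) => //.
    by move=> x y -> ->; rewrite minxx.
  by move=> i _; rewrite mxE.
have := cvg_vmax w1; rewrite max1 => vmax1.
have := cvg_vmin w1; rewrite min1 => vmin1.
have lim0 : `|1 / 1 - 1| = 0 :> R by rewrite divr1 subrr normr0.
rewrite -lim0; apply: cvg_norm; apply: cvgB; last exact: cvg_cst.
by apply: cvg_divr; [exact: oner_neq0 | exact: vmin1 | exact: vmax1].
Qed.

Lemma sk_gap_cvg : sk_gap (S n) @[n --> \oo] --> (0 : R).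
Proof.
have p_gt0 : (0 < p)%N.
  rewrite lt0n; apply: contraTneq r_sum_gt0 => p0; rewrite -leNgt.
  by rewrite big1 // => -[i i_lt]; exfalso; rewrite p0 in i_lt.
have q_gt0 : (0 < q)%N.
  rewrite lt0n; apply: contraTneq r_sum_gt0 => q0; rewrite -leNgt rc_sum.
  by rewrite big1 // => -[i i_lt]; exfalso; rewrite q0 in i_lt.
have fc1 j : sk_col_factors c (S n) 0 j @[n --> \oo] --> (1 : R).
  under eq_cvg do rewrite mxE.
  have -> : 1 = (\sum_i X i j) / c 0 j :> R by rewrite X_col divff // lt0r_neq0.
  by apply: cvg_divr; [exact: lt0r_neq0 | exact: cvg_sumr | exact: cvg_cst].
have fr1 i : sk_row_factors r (sk_col_step c (S n)) 0 i @[n --> \oo] --> (1 : R).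
  under eq_cvg => n.
    rewrite mxE; under eq_bigr do rewrite mxE. over.
  have -> : 1 = (\sum_j X i j) / r 0 i :> R by rewrite X_row divff // lt0r_neq0.
  apply: cvg_divr; [exact: lt0r_neq0 | | exact: cvg_cst].
  apply: cvg_sumr => j; rewrite -[X i j]divr1.
  by apply: cvg_divr; [exact: oner_neq0 | exact: mx_cvg | exact: fc1].
rewrite -[0]maxxx; apply: cvg_maxr; exact: cvg_spread_const1.
Qed.

Lemma sk_balance_cvg :
  let B n := sk_balance (S n) in let E := sk_balance (SkState X l rr) in
  (forall i, sk_left (B n) 0 i @[n --> \oo] --> sk_left E 0 i) /\
  (forall j, sk_right (B n) 0 j @[n --> \oo] --> sk_right E 0 j).
Proof.
move=> B E.
have ratio_cvg : Num.sqrt (vmax (sk_right (S n)) / vmax (sk_left (S n)))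
    @[n --> \oo] --> Num.sqrt (vmax rr / vmax l).
  apply: continuous_cvg; first exact: sqrt_continuous.
  by apply: cvg_divr; [exact: lt0r_neq0 | exact: cvg_vmax | exact: cvg_vmax].
split=> i; rewrite /B /E /=; under eq_cvg do rewrite mxE; rewrite mxE.
  exact: cvgM.
apply: cvgM => //; apply: (@cvgV _ _ _ _ _ _ _ ratio_cvg).
by rewrite lt0r_neq0 // sqrtr_gt0 divr_gt0.
Qed.

(** From some index [K0] on, stopping gives an output within [eps].  Among the
    finitely many earlier states, those of positive gap are excluded by a small
    tolerance, and those of gap [0] are fixed by the iteration, so that they
    coincide with a state of index at least [K0]. *)
Theorem sk_computes_cvg : let E := sk_balance (SkState X l rr) in
  sk_computes N r c X (diag_mx (sk_left E)) (diag_mx (sk_right E)).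
Proof.
move=> E eps eps_gt0; have [left_B right_B] := sk_balance_cvg.
pose close S := [/\ mx_close eps (sk_mx S) X,
  mx_close eps (diag_mx (sk_left S)) (diag_mx (sk_left E)) &
  mx_close eps (diag_mx (sk_right S)) (diag_mx (sk_right E))].
have [K0 K0P] : exists K0, forall n, (K0 <= n)%N -> close (sk_balance (S n)).
  have diag_close k (v w : 'rV[R]_k) :
      (forall i, `|w 0 i - v 0 i| <= eps) -> mx_close eps (diag_mx v) (diag_mx w).
    move=> vw i j; rewrite !mxE; case: (i == j); rewrite ?mulr1n ?mulr0n.
      by rewrite distrC.
    by rewrite subrr normr0 ltW.
  have e1 : \forall n \near \oo, forall ij : 'I_p * 'I_q,
      `|X ij.1 ij.2 - sk_mx (S n) ij.1 ij.2| <= eps.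
    by apply: filter_forall => -[i j]; move/cvgrPdist_le: (@mx_cvg i j); apply.
  have e2 : \forall n \near \oo, forall i : 'I_p,
      `|sk_left E 0 i - sk_left (sk_balance (S n)) 0 i| <= eps.
    by apply: filter_forall => i; move/cvgrPdist_le: (left_B i); apply.
  have e3 : \forall n \near \oo, forall j : 'I_q,
      `|sk_right E 0 j - sk_right (sk_balance (S n)) 0 j| <= eps.
    by apply: filter_forall => i; move/cvgrPdist_le: (right_B i); apply.
  have [K0 _ K0P] : \forall n \near \oo, close (sk_balance (S n)).
    near=> n; split.
    - move=> i j; rewrite distrC.
      have : forall ij : 'I_p * 'I_q,
        `|X ij.1 ij.2 - sk_mx (S n) ij.1 ij.2| <= eps by near: n.
      by move=> /(_ (i, j)).
    - by apply: diag_close; near: n.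
    - by apply: diag_close; near: n.
  by exists K0.
have [tol0 tol0_gt0 tol0P] : exists2 tol0 : R, 0 < tol0 &
    forall n, (n < K0)%N -> sk_gap (S n) <= tol0 -> sk_gap (S n) = 0.
  elim: K0 {K0P} => [|K0 [tol0 tol0_gt0 IH]]; first by exists 1.
  have [g0|g_neq0] := eqVneq (sk_gap (S K0)) 0.
    exists tol0 => // n; rewrite ltnS leq_eqVlt => /predU1P[-> //|]; exact: IH.
  have g_gt0 : 0 < sk_gap (S K0) by rewrite lt_def g_neq0 sk_gap_ge0.
  exists (Num.min tol0 (sk_gap (S K0) / 2)) => [|n].
    by rewrite lt_min tol0_gt0 divr_gt0.
  rewrite ltnS leq_eqVlt le_min => /predU1P[->|nK0] /andP[le1 le2]; last exact: IH.
  by move: le2 g_gt0; lra.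
exists tol0 => // tol /andP[tol_gt0 tol_le].
have [K stopK] : exists K, sk_stop r c tol (S K).
  have /cvgrPdist_le/(_ _ tol_gt0)[K _ KP] := @sk_gap_cvg.
  exists K; rewrite sk_stopE; have := KP K (leqnn K).
  by rewrite /= sub0r normrN ger0_norm ?sk_gap_ge0.
exists K.+1 => kmax K_lt.
have exP : exists n, sk_stop r c tol (S n) by exists K.
case: (ex_minnP exP) => n stop_n n_min.
rewrite /sinkhorn_knopp (sk_loop_first_stop (n := n)) //; first last.
- by move=> i; apply: contraTN => /n_min; rewrite -leqNgt.
- exact: leq_ltn_trans (n_min _ stopK) _.
suff [? ? ?] : close (sk_balance (S n.+1)) by split.
have [nK0|K0n] := ltnP n K0; last by apply: K0P; rewrite ltnW.
have gap0 : sk_gap (S n) = 0.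
  by apply: tol0P => //; apply: le_trans tol_le; rewrite -sk_stopE.
have S_fixed : sk_pass r c (S n) = S n by exact: sk_pass_fixed.
have S_const m : S (m + n)%N = S n.
  by elim: m => // m IH; rewrite addSn -[S _.+1]/(sk_pass r c (S _)) IH.
rewrite -[S n.+1]/(sk_pass r c (S n)) S_fixed -(S_const K0).
by apply: K0P; rewrite leq_addr.
Unshelve. all: by end_near. Qed.

End StoppedAlgorithm.

(** * The Sinkhorn-Knopp iteration for a symmetric matrix *)

Section SymmetricSinkhorn.
Local Open Scope classical_set_scope.
Local Open Scope ring_scope.
Variables (R : realType) (k : nat) (N : 'M[R]_k).
Hypothesis k_gt0 : (0 < k)%N.
Hypothesis N_ge0 : forall i j, 0 <= N i j.
Hypothesis N_diag : forall i, 0 < N i i.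
Hypothesis N_sym : forall i j, N i j = N j i.

Let one : 'rV[R]_k := const_mx 1.
Let pass := sk_pass one one.
Let S n := iter n pass (sk_init N one).

Definition sk_scaled (S : sk_state (R := R) (p := k) (q := k)) : Prop :=
  [/\ forall i, 0 < sk_left S 0 i, forall j, 0 < sk_right S 0 j &
      forall i j, sk_mx S i j = sk_left S 0 i * N i j * sk_right S 0 j].

Lemma row_sum_gt0 (v : 'rV[R]_k) : (forall i, 0 < v 0 i) ->
  forall i, 0 < \sum_j N i j * v 0 j.
Proof.
move=> v_gt0 i; rewrite (bigD1 i) //= ltr_pwDl ?mulr_gt0 // sumr_ge0 // => j _.
by rewrite mulr_ge0 // ltW.
Qed.

Lemma sk_init_scaled : sk_scaled (sk_init N one).
Proof.
have s_gt0 : 0 < (\sum_j one 0 j) / (\sum_i \sum_j N i j).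
  have sum_gt0 (f : 'I_k -> R) : (forall i, 0 < f i) -> 0 < \sum_i f i.
    move=> f_gt0; rewrite (bigD1 (Ordinal k_gt0)) //= ltr_pwDl //.
    by rewrite sumr_ge0 // => i _; rewrite ltW.
  apply: divr_gt0; apply: sum_gt0 => i; first by rewrite mxE.
  by rewrite (bigD1 i) //= ltr_pwDl // sumr_ge0.
split=> [i|j|i j] /=; rewrite !mxE ?sqrtr_gt0 //.
by rewrite [RHS]mulrAC -expr2 sqr_sqrtr // ltW.
Qed.

(** The scaling that a half pass updates cancels against its updating factors:
    the new right scaling depends on the old left scaling alone, and the new
    left scaling on the new right one. *)
Lemma sk_pass_scaled S0 : sk_scaled S0 ->
  [/\ sk_scaled (pass S0),
      forall j, sk_right (pass S0) 0 j = (\sum_i N j i * sk_left S0 0 i)^-1 &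
      forall i, sk_left (pass S0) 0 i = (\sum_j N i j * sk_right (pass S0) 0 j)^-1].
Proof.
case=> left_gt0 right_gt0 mxE0; set S1 := sk_col_step one S0.
have colE j : sk_col_factors one S0 0 j =
    sk_right S0 0 j * \sum_i N j i * sk_left S0 0 i.
  rewrite !mxE divr1 mulr_sumr; apply: eq_bigr => i _.
  by rewrite mxE0 (N_sym j i); ring.
have right1 j : sk_right S1 0 j = (\sum_i N j i * sk_left S0 0 i)^-1.
  by rewrite mxE colE invfM mulrA divff ?mul1r // gt_eqF.
have right1_gt0 j : 0 < sk_right S1 0 j by rewrite right1 invr_gt0 row_sum_gt0.
have mx1 i j : sk_mx S1 i j = sk_left S0 0 i * N i j * sk_right S1 0 j.
  by rewrite !mxE mxE0 mulrA.
have rowE i : sk_row_factors one S1 0 i =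
    sk_left S0 0 i * \sum_j N i j * sk_right S1 0 j.
  rewrite [LHS]mxE [one _ _]mxE divr1 mulr_sumr; apply: eq_bigr => j _.
  by rewrite mx1 mulrA.
have left1 i : sk_left (pass S0) 0 i = (\sum_j N i j * sk_right S1 0 j)^-1.
  by rewrite /pass /sk_pass -/S1 [LHS]mxE rowE invfM mulrA divff ?mul1r // gt_eqF.
split=> //; split=> // [i|i j]; first by rewrite left1 invr_gt0 row_sum_gt0.
have -> : sk_left (pass S0) 0 i = sk_left S0 0 i / sk_row_factors one S1 0 i.
  by rewrite /pass /sk_pass -/S1 [LHS]mxE.
by rewrite /pass /sk_pass -/S1 [LHS]mxE mx1; ring.
Qed.

Lemma sk_iter_scaled n : sk_scaled (S n).
Proof.
elim: n => [|n IH]; first exact: sk_init_scaled.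
by case: (sk_pass_scaled IH).
Qed.

Lemma sk_iter_total n : \sum_i \sum_j sk_mx (S n) i j = \sum_j one 0 j.
Proof.
case: n => [|n] /=.
  under eq_bigr => i _ do under eq_bigr => j _ do rewrite mxE.
  under eq_bigr => i _ do rewrite -mulr_sumr.
  rewrite -mulr_sumr divfK // gt_eqF //.
  rewrite (bigD1 (Ordinal k_gt0)) //=; apply: ltr_pwDl.
    by rewrite (bigD1 (Ordinal k_gt0)) //= ltr_pwDl // sumr_ge0.
  by rewrite sumr_ge0 // => i _; rewrite sumr_ge0.
have [[left_gt0 right_gt0 mxE0] rE lE] := sk_pass_scaled (sk_iter_scaled n).
apply: eq_bigr => i _; rewrite [RHS]mxE.
under eq_bigr => j _ do rewrite mxE0 -mulrA.
rewrite -mulr_sumr lE mulVf // gt_eqF //; exact: row_sum_gt0.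
Qed.

Variable u : 'rV[R]_k.
Hypothesis u_gt0 : forall i, 0 < u 0 i.
Hypothesis u_bal : forall i, u 0 i * (\sum_j N i j * u 0 j) = 1.

Let P := diag_mx u *m N *m diag_mx u.

Lemma scaled_mxE i j : P i j = u 0 i * N i j * u 0 j.
Proof. by rewrite /P mul_mx_diag mul_diag_mx !mxE. Qed.

Lemma scaled_mx_ge0 i j : 0 <= P i j.
Proof. by rewrite scaled_mxE !mulr_ge0 // ltW. Qed.

Lemma scaled_mx_gt0 i j : (0 < P i j) = (0 < N i j).
Proof. by rewrite scaled_mxE pmulr_lgt0 // pmulr_rgt0. Qed.

Lemma scaled_mx_row i : \sum_j P i j = 1.
Proof.
rewrite -(u_bal i) mulr_sumr; apply: eq_bigr => j _.
by rewrite scaled_mxE mulrA.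
Qed.

Lemma scaled_mx_col j : \sum_i P i j = 1.
Proof.
rewrite -(scaled_mx_row j); apply: eq_bigr => i _.
by rewrite !scaled_mxE (N_sym i j); ring.
Qed.

Let y n : 'cV[R]_k := \col_i (sk_left (S n) 0 i / u 0 i).

Lemma scaled_avgE (v : 'rV[R]_k) i :
  (P *m \col_j (v 0 j / u 0 j)) i 0 = u 0 i * (\sum_j N i j * v 0 j).
Proof.
rewrite mxE mulr_sumr; apply: eq_bigr => j _.
by rewrite scaled_mxE mxE; field; rewrite gt_eqF.
Qed.

Lemma sk_right_recip n j :
  sk_right (S n.+1) 0 j = u 0 j * recip_avg P (y n) j 0.
Proof.
have [_ -> _] := sk_pass_scaled (sk_iter_scaled n).
by rewrite mxE scaled_avgE invfM mulrA divff ?mul1r // gt_eqF.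
Qed.

(** Relative to a vector [u] that makes [diag u N diag u] doubly stochastic,
    a pass is two reciprocal averages. *)
Lemma sk_left_recip n : y n.+1 = recip_avg P (recip_avg P (y n)).
Proof.
apply/colP => i; rewrite [LHS]mxE [RHS]mxE.
have -> : recip_avg P (y n) = \col_j (sk_right (S n.+1) 0 j / u 0 j).
  by apply/colP => j; rewrite [RHS]mxE sk_right_recip mulrAC divff ?mul1r // gt_eqF.
rewrite scaled_avgE; have [_ _ ->] := sk_pass_scaled (sk_iter_scaled n).
by rewrite mulrC invfM.
Qed.

Lemma sk_left_iter n :
  y n = iter n (fun z => recip_avg P (recip_avg P z)) (y 0%N).
Proof. by elim: n => // n IH; rewrite sk_left_recip IH. Qed.

Variable w : 'rV[R]_k.
Hypothesis w_gt0 : forall i, 0 < w 0 i.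
Hypothesis w_const : forall i j, 0 < N i j -> w 0 i = w 0 j.
Hypothesis left_ratio_cvg :
  forall i, (sk_left (S n) 0 i / u 0 i) @[n --> \oo] --> w 0 i.

Lemma vmax_gt0 (v : 'rV[R]_k) : (forall i, 0 < v 0 i) -> 0 < vmax v.
Proof.
move=> v_gt0; apply: lt_le_trans (v_gt0 (Ordinal k_gt0)) _.
exact: (le_bigmax 0 (fun i => v 0 i)).
Qed.

(** The support of row [j] only meets entries where [w] has the value
    [w_j]. *)
Lemma avg_blockwise_const j : \sum_i P j i * w 0 i = w 0 j.
Proof.
rewrite -[RHS]mul1r -(scaled_mx_row j) mulr_suml; apply: eq_bigr => i _.
have [/w_const -> //|] := ltP 0 (N j i).
rewrite scaled_mxE => N0; have -> : N j i = 0 by apply/eqP; rewrite eq_le N0 N_ge0.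
by rewrite mulr0 !mul0r.
Qed.

(** If the left scalings tend to [u w] then the right ones tend to [u / w]
    and the matrix tends to [diag u N diag u]: the factors [w_i / w_j] disappear,
    because [w_i = w_j] wherever [N_ij] is nonzero. *)
Theorem sk_computes_symmetric :
  let E := sk_balance (SkState P (\row_i (u 0 i * w 0 i)) (\row_i (u 0 i / w 0 i))) in
  sk_computes N one one P (diag_mx (sk_left E)) (diag_mx (sk_right E)).
Proof.
have y_cvg i : y n i 0 @[n --> \oo] --> w 0 i.
  by under eq_cvg do rewrite mxE; exact: left_ratio_cvg.
have left_cvg i : sk_left (S n) 0 i @[n --> \oo] --> u 0 i * w 0 i.
  have -> : (fun n => sk_left (S n) 0 i) = (fun n => u 0 i * y n i 0).
    by apply/funext => n; rewrite mxE mulrC divfK // gt_eqF.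
  by apply: cvgM; [exact: cvg_cst | exact: y_cvg].
have right_cvg j : sk_right (S n) 0 j @[n --> \oo] --> u 0 j / w 0 j.
  have rightE n : sk_right (S n.+1) 0 j = u 0 j / \sum_i P j i * y n i 0.
    by rewrite sk_right_recip recip_avgE mxE.
  rewrite -(cvg_shiftS (fun n => sk_right (S n) 0 j)) /=.
  under eq_cvg => n do rewrite rightE.
  rewrite -(avg_blockwise_const j).
  apply: cvg_divr; [|exact: cvg_cst|].
    by rewrite avg_blockwise_const gt_eqF.
  by apply: cvg_sumr => i; apply: cvgM; [exact: cvg_cst | exact: y_cvg].
apply: sk_computes_cvg.
- rewrite (bigD1 (Ordinal k_gt0)) //= ltr_pwDl ?mxE // sumr_ge0 // => i _.
  by rewrite mxE.
- by [].
- by move=> i; rewrite mxE.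
- by move=> i; rewrite mxE.
- exact: sk_iter_total.
- move=> i j.
  have -> : P i j = u 0 i * w 0 i * N i j * (u 0 j / w 0 j).
    have [Nij|Nij] := ltP 0 (N i j).
      by rewrite scaled_mxE (w_const Nij); field; rewrite gt_eqF.
    have N0 : N i j = 0 by apply/eqP; rewrite eq_le Nij N_ge0.
    by rewrite scaled_mxE N0; ring.
  have -> : (fun n => sk_mx (iter n (sk_pass one one) (sk_init N one)) i j) =
      (fun n => sk_left (S n) 0 i * N i j * sk_right (S n) 0 j).
    by apply/funext => n; case: (sk_iter_scaled n) => _ _ <-.
  apply: cvgM; last exact: right_cvg.
  by apply: cvgM; [exact: left_cvg | exact: cvg_cst].
- by move=> i; rewrite mxE; exact: left_cvg.
- by move=> i; rewrite mxE; exact: right_cvg.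
- by apply: vmax_gt0 => i; rewrite mxE mulr_gt0.
- by apply: vmax_gt0 => i; rewrite mxE divr_gt0.
- by move=> i; rewrite scaled_mx_row mxE.
- by move=> i; rewrite scaled_mx_col mxE.
Qed.

End SymmetricSinkhorn.

Section BalancedLimit.
Variables (R : realType) (k : nat) (u w : 'rV[R]_k) (X : 'M[R]_k).
Hypothesis k_gt0 : (0 < k)%N.
Hypothesis u_gt0 : forall i, 0 < u 0 i.
Hypothesis w_gt0 : forall i, 0 < w 0 i.

Let E := sk_balance (SkState X (\row_i (u 0 i * w 0 i)) (\row_i (u 0 i / w 0 i))).

Lemma balance_factor_gt0 :
  0 < Num.sqrt (vmax (\row_i (u 0 i / w 0 i)) / vmax (\row_i (u 0 i * w 0 i))).
Proof.
by rewrite sqrtr_gt0 divr_gt0 ?vmax_gt0 // => i; rewrite mxE ?divr_gt0 ?mulr_gt0.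
Qed.

Lemma balance_gt0 :
  (forall i, 0 < sk_left E 0 i) /\ (forall i, 0 < sk_right E 0 i).
Proof.
by split=> i; rewrite !mxE mulr_gt0 ?invr_gt0 ?balance_factor_gt0 // ?divr_gt0 ?mulr_gt0.
Qed.

Lemma balance_prod i : sk_left E 0 i * sk_right E 0 i = u 0 i ^+ 2.
Proof.
by rewrite !mxE; field; rewrite !gt_eqF // balance_factor_gt0.
Qed.

(** The scalings are then [lam u] and [u / lam], and balancing multiplies the
    first and divides the second by [lam^-1]. *)
Lemma balance_const : (forall i j, w 0 i = w 0 j) ->
  sk_left E = u /\ sk_right E = u.
Proof.
move=> w_const; set i0 := Ordinal k_gt0; set lam := w 0 i0.
have lam_gt0 : 0 < lam by exact: w_gt0.
have vmaxZ a (v : 'rV[R]_k) : 0 < a -> vmax (a *: v) = a * vmax v.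
  move=> a_gt0; apply: (big_ind2 (fun x y => x = a * y)).
  - by rewrite mulr0.
  - by move=> _ x _ y -> ->; rewrite maxr_pMr // ltW.
  - by move=> i _; rewrite mxE.
have leftE : \row_i (u 0 i * w 0 i) = lam *: u.
  by apply/rowP => i; rewrite !mxE (w_const i i0) mulrC.
have rightE : \row_i (u 0 i / w 0 i) = lam^-1 *: u.
  by apply/rowP => i; rewrite !mxE (w_const i i0) mulrC.
have vmax_u : 0 < vmax u by exact: vmax_gt0.
have ratio : Num.sqrt (vmax (lam^-1 *: u) / vmax (lam *: u)) = lam^-1.
  rewrite !vmaxZ ?invr_gt0 //.
  have -> : lam^-1 * vmax u / (lam * vmax u) = lam^-1 ^+ 2.
    by field; rewrite !gt_eqF.
  by rewrite sqrtr_sqr gtr0_norm // invr_gt0.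
rewrite /E /sk_balance /= leftE rightE ratio invrK !scalerA.
by rewrite mulVf ?mulfV ?gt_eqF // !scale1r.
Qed.

End BalancedLimit.

(** * The matrix of the theorem *)

(** Any two indices are joined by a walk of length four along positive
    entries: the walk stays on one side, or crosses by the edge between [l] and
    [r]; loops make up the length. *)
Lemma two_cliques_primitive (R : realType) k (P : 'M[R]_k) (side : 'I_k -> bool)
    (l r : 'I_k) :
  (forall i j, 0 <= P i j) ->
  (forall i j, side i = side j -> 0 < P i j) ->
  side l != side r -> 0 < P l r -> 0 < P r l ->
  forall i j, 0 < (P ^+ 4) i j.
Proof.
move=> P_ge0 P_side lr Plr Prl i j.
have step (Q : 'M[R]_k) a b c : (forall i j, 0 <= Q i j) ->
    0 < P a b -> 0 < Q b c -> 0 < (P *m Q) a c.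
  move=> Q_ge0 ab bc; rewrite mxE (bigD1 b) //= ltr_pwDl ?mulr_gt0 //.
  by rewrite sumr_ge0 // => e _; rewrite mulr_ge0.
have pow_ge0 n a b : 0 <= (P ^+ n) a b.
  elim: n a b => [|n IH] a b; first by rewrite expr0 mxE; case: eqP.
  by rewrite exprS -[_ * _]/(_ *m _) mxE sumr_ge0 // => e _; rewrite mulr_ge0.
have walk n a b c : 0 < P a b -> 0 < (P ^+ n) b c -> 0 < (P ^+ n.+1) a c.
  by move=> ab bc; rewrite exprS; apply: step bc.
have walk1 a b : 0 < P a b -> 0 < (P ^+ 1) a b by rewrite expr1.
have [ij|ij] := eqVneq (side i) (side j).
  apply: (walk _ _ j); first exact: P_side.
  by do 2![apply: (walk _ _ j); first exact: P_side]; apply: walk1; exact: P_side.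
have [il|il] := eqVneq (side i) (side l).
  have rj : side r = side j.
    by case: (side i) (side j) (side l) (side r) ij il lr => [] [] [] [].
  apply: (walk _ _ l); first exact: P_side.
  apply: (walk _ _ r) => //.
  by apply: (walk _ _ j); [|apply: walk1]; exact: P_side.
have ir : side i = side r.
  by case: (side i) (side j) (side l) (side r) ij il lr => [] [] [] [].
have lj : side l = side j.
  by case: (side i) (side j) (side l) (side r) ij il lr {ir} => [] [] [] [].
apply: (walk _ _ r); first exact: P_side.
apply: (walk _ _ l) => //.
by apply: (walk _ _ j); [|apply: walk1]; exact: P_side.
Qed.

Section AlphaMatrix.
Variables (R : realType) (m n : nat) (A B : 'M[R[i]]_(m, n)) (alpha : R).
Hypotheses (m_gt0 : (0 < m)%N) (n_gt0 : (0 < n)%N) (alpha_gt0 : 0 < alpha).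

Let N := Malpha_sq A B alpha.
Let M := sum_abs_sq A B.

Definition in_left (i : 'I_(m + n)) : bool := (i < m)%N.

Lemma ones_outer k i j : (ones k *m (ones k)^T) i j = 1 :> R.
Proof. by rewrite mxE big_ord1 !mxE mulr1. Qed.

Lemma Malpha_sq_ul i j : N (lshift n i) (lshift n j) = alpha ^+ 2 / m%:R ^+ 2.
Proof. by rewrite /N block_mxEul mxE ones_outer mulr1. Qed.

Lemma Malpha_sq_ur i j : N (lshift n i) (rshift m j) = M i j.
Proof. by rewrite /N block_mxEur. Qed.

Lemma Malpha_sq_dl i j : N (rshift m i) (lshift n j) = M j i.
Proof. by rewrite /N block_mxEdl mxE. Qed.

Lemma Malpha_sq_dr i j : N (rshift m i) (rshift m j) = alpha ^+ 2 / n%:R ^+ 2.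
Proof. by rewrite /N block_mxEdr mxE ones_outer mulr1. Qed.

Lemma in_left_lshift i : in_left (lshift n i).
Proof. by rewrite /in_left /= ltn_ord. Qed.

Lemma in_left_rshift i : in_left (rshift m i) = false.
Proof. by rewrite /in_left /= ltnNge leq_addr. Qed.

Lemma sum_abs_sq_ge0 i j : 0 <= M i j.
Proof. by rewrite !mxE addr_ge0 ?sqr_ge0. Qed.

Lemma Malpha_sq_sym i j : N i j = N j i.
Proof.
by case: (split_ordP i) => a ->; case: (split_ordP j) => b ->;
   rewrite ?Malpha_sq_ul ?Malpha_sq_ur ?Malpha_sq_dl ?Malpha_sq_dr.
Qed.

Lemma Malpha_sq_clique i j : in_left i = in_left j -> 0 < N i j.
Proof.
case: (split_ordP i) => a ->; case: (split_ordP j) => b ->;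
  rewrite ?in_left_lshift ?in_left_rshift // => _;
  by rewrite ?Malpha_sq_ul ?Malpha_sq_dr divr_gt0 ?exprn_gt0 ?ltr0n.
Qed.

Lemma Malpha_sq_ge0 i j : 0 <= N i j.
Proof.
case: (split_ordP i) => a ->; case: (split_ordP j) => b ->;
  rewrite ?Malpha_sq_ul ?Malpha_sq_ur ?Malpha_sq_dl ?Malpha_sq_dr ?sum_abs_sq_ge0 //;
  by rewrite divr_ge0 ?sqr_ge0.
Qed.

Lemma sum_abs_sq_eq0 : M = 0 -> A = 0 /\ B = 0.
Proof.
move=> /matrixP M0.
have AB0 i j : A i j = 0 /\ B i j = 0.
  have := M0 i j; rewrite !mxE => /eqP.
  rewrite paddr_eq0 ?sqr_ge0 // !sqrf_eq0 => /andP[/eqP a0 /eqP b0].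
  by split; apply: ComplexField.Normc.eq0_normc.
by split; apply/matrixP => i j; rewrite !mxE; case: (AB0 i j).
Qed.

Variable u : 'rV[R]_(m + n).
Hypothesis u_gt0 : forall i, 0 < u 0 i.
Hypothesis u_bal : forall i, u 0 i * (\sum_j N i j * u 0 j) = 1.

(** When the off-diagonal blocks vanish, the rows [i] and [j] of [N] are equal
    as soon as [N_ij] is nonzero, and the balance equation determines [u_i] from
    the row [i]. *)
Lemma balanced_clique_const i j : M = 0 -> 0 < N i j -> u 0 i = u 0 j.
Proof.
move=> M0 Nij; have M0E a b : M a b = 0 by rewrite M0 mxE.
have rows l : N i l = N j l.
  move: Nij; case: (split_ordP i) => a ->; case: (split_ordP j) => b ->;
    rewrite ?(Malpha_sq_ur, Malpha_sq_dl) ?M0E ?ltxx // => _;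
    by case: (split_ordP l) => e ->;
      rewrite !(Malpha_sq_ul, Malpha_sq_ur, Malpha_sq_dl, Malpha_sq_dr) ?M0E.
have sumE : \sum_l N j l * u 0 l = \sum_l N i l * u 0 l.
  by apply: eq_bigr => l _; rewrite rows.
have := u_bal j; rewrite sumE -(u_bal i) => /mulIf -> //.
apply: contra_eq_neq (u_bal i) => ->.
by rewrite mulr0 eq_sym oner_eq0.
Qed.

Lemma balanced_square i : M = 0 ->
  u 0 i ^+ 2 * (alpha ^+ 2 / (if in_left i then m else n)%:R) = 1.
Proof.
move=> M0; have M0E a b : M a b = 0 by rewrite M0 mxE.
rewrite -[RHS](u_bal i) expr2 -mulrA; congr (_ * _).
have same j : N i j * u 0 j = N i j * u 0 i.
  have [Nij|Nij] := ltP 0 (N i j); first by rewrite (balanced_clique_const M0 Nij).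
  have -> : N i j = 0 by apply/eqP; rewrite eq_le Nij Malpha_sq_ge0.
  by rewrite !mul0r.
under eq_bigr do rewrite same.
rewrite -mulr_suml mulrC; congr (_ * _).
rewrite big_split_ord /=.
case: (split_ordP i) => a ->; rewrite ?in_left_lshift ?in_left_rshift.
  under eq_bigr do rewrite Malpha_sq_ul.
  under [X in _ + X]eq_bigr do rewrite Malpha_sq_ur M0E.
  rewrite big1_eq addr0 sumr_const card_ord -mulr_natr; field.
  by rewrite pnatr_eq0 -lt0n.
under eq_bigr do rewrite Malpha_sq_dl M0E.
under [X in _ + X]eq_bigr do rewrite Malpha_sq_dr.
rewrite big1_eq add0r sumr_const card_ord -mulr_natr; field.
by rewrite pnatr_eq0 -lt0n.
Qed.

Lemma balanced_const i j : M = 0 -> m = n -> u 0 i = u 0 j.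
Proof.
move=> M0 mn; have nE (b : bool) : (if b then m else n) = n by case: b.
have := balanced_square j M0; rewrite -[RHS](balanced_square i M0) !nE.
move=> /mulIf uu; apply/eqP; rewrite -(@eqrXn2 _ 2) ?ltW // uu //.
by rewrite mulf_neq0 ?invr_eq0 ?sqrf_eq0 ?gt_eqF ?ltr0n.
Qed.

Local Open Scope classical_set_scope.
Local Open Scope ring_scope.

(** The left scaling starts from a multiple of the vector of ones.  If the
    off-diagonal blocks vanish then its ratio to [u] is constant on each block,
    hence unchanged by reciprocal averages, and it is constant altogether when
    [m = n].  Otherwise the matrix is primitive and the iteration contracts. *)
Lemma sinkhorn_left_limit :
  let S k := iter k (sk_pass (const_mx 1) (const_mx 1)) (sk_init N (const_mx 1)) in
  exists w : 'rV[R]_(m + n), [/\ forall i, 0 < w 0 i,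
    forall i j, 0 < N i j -> w 0 i = w 0 j,
    forall i, (sk_left (S k) 0 i / u 0 i) @[k --> \oo] --> w 0 i &
    [|| A != 0, B != 0 | m == n] -> forall i j, w 0 i = w 0 j].
Proof.
move=> S; pose y k : 'rV[R]_(m + n) := \row_i (sk_left (S k) 0 i / u 0 i).
have k_gt0 : (0 < m + n)%N by rewrite addn_gt0 m_gt0.
have N_diag i : 0 < N i i by exact: Malpha_sq_clique.
have y0_gt0 i : 0 < y 0%N 0 i.
  have [left_gt0 _ _] := sk_iter_scaled k_gt0 Malpha_sq_ge0 N_diag Malpha_sq_sym 0.
  by rewrite mxE divr_gt0.
pose P := diag_mx u *m N *m diag_mx u.
pose z k : 'cV[R]_(m + n) := \col_i (sk_left (S k) 0 i / u 0 i).
have yz k i : y k 0 i = z k i 0 by rewrite !mxE.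
have zE k : z k = iter k (fun z => recip_avg P (recip_avg P z)) (z 0%N).
  exact: (sk_left_iter k_gt0 Malpha_sq_ge0 N_diag Malpha_sq_sym u_gt0).
have P_ge0 := scaled_mx_ge0 Malpha_sq_ge0 u_gt0.
have P_gt0 := scaled_mx_gt0 N u_gt0.
have P_row := scaled_mx_row u_bal.
have [M0|M0] := eqVneq M 0.
  have y0E i : y 0%N 0 i = sk_left (sk_init N (const_mx 1)) 0 i / u 0 i.
    by rewrite mxE.
  have y0_const i j : u 0 i = u 0 j -> y 0%N 0 i = y 0%N 0 j.
    by move=> uij; rewrite !y0E uij !mxE.
  exists (y 0%N); split=> // [i j Nij|i|].
  - by apply: y0_const; exact: balanced_clique_const.
  - have fixed : recip_avg P (recip_avg P (z 0%N)) = z 0%N.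
      have avgE (v : 'cV[R]_(m + n)) i' :
          (forall j, 0 < N i' j -> v i' 0 = v j 0) -> (P *m v) i' 0 = v i' 0.
        move=> vN; rewrite mxE -[RHS]mul1r -(P_row i') mulr_suml.
        apply: eq_bigr => j _; have [/vN -> //|Nij] := ltP 0 (N i' j).
        have N0 : N i' j = 0 by apply/eqP; rewrite eq_le Nij Malpha_sq_ge0.
        by rewrite scaled_mxE N0 mulr0 !mul0r.
      have z0N i' j : 0 < N i' j -> z 0%N i' 0 = z 0%N j 0.
        by move=> Nij; rewrite -!yz; apply: y0_const; exact: balanced_clique_const.
      have recE i' : recip_avg P (z 0%N) i' 0 = (z 0%N i' 0)^-1.
        by rewrite recip_avgE avgE // => j; exact: z0N.
      apply/colP => i'; rewrite recip_avgE avgE ?recE ?invrK // => j Nij.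
      by rewrite !recE (z0N _ _ Nij).
    have -> : (fun k => sk_left (S k) 0 i / u 0 i) = (fun=> y 0%N 0 i).
      apply/funext => k; transitivity (z k i 0); first by rewrite mxE.
      by rewrite yz zE; congr (fun_of_matrix _ _ _); elim: k => //= k ->.
    exact: cvg_cst.
  have [-> ->] := sum_abs_sq_eq0 M0; rewrite !eqxx /= => /eqP mn i j.
  by apply: y0_const; exact: balanced_const.
have [a [b Mab]] : exists a b, M a b != 0.
  apply/not_existsP => Mn; case/eqP: M0; apply/matrixP => a b; rewrite [RHS]mxE.
  apply/eqP/negP => Mab; case: (Mn a); exists b; exact/negP.
have Mab_gt0 : 0 < M a b by rewrite lt_def Mab sum_abs_sq_ge0.
have P4 : forall i j, 0 < (P ^+ (2 * 2)) i j.
  apply: (@two_cliques_primitive _ _ _ in_left (lshift n a) (rshift m b)) => //.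
  - by move=> i j ij; rewrite P_gt0 Malpha_sq_clique.
  - by rewrite in_left_lshift in_left_rshift.
  - by rewrite P_gt0 Malpha_sq_ur.
  - by rewrite P_gt0 Malpha_sq_dl.
have z0_gt0 i : 0 < z 0%N i 0 by rewrite -yz.
have [lam lam_gt0 z_cvg] := recip_avg2_cvg P_ge0 P_row k_gt0 P4 z0_gt0.
exists (const_mx lam); split=> [i|i j _|i|_ i j]; rewrite ?mxE //.
have -> : (fun k => sk_left (S k) 0 i / u 0 i) =
    (fun k => iter k (fun z => recip_avg P (recip_avg P z)) (z 0%N) i 0).
  by apply/funext => k; rewrite -zE mxE.
exact: z_cvg.
Qed.

End AlphaMatrix.

(** * The theorem *)

Theorem theorem5p2 (R : realType) (m n : nat) (m_gt0 : (0 < m)%N)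
    (n_gt0 : (0 < n)%N) (A B : 'M[R[i]]_(m, n)) (alpha c : R)
    (alpha_gt0 : 0 < alpha) (c_gt0 : 0 < c) (Malpha : 'M[R]_(m + n))
    (Malpha_ge0 : forall i j, 0 <= Malpha i j)
    (MalphaE : esq_mx Malpha = Malpha_sq A B alpha) :
  [/\ equivalent (scaling_problem A B alpha c) (entry_sum_problem A B alpha c),
      equivalent (scaling_problem A B alpha c) (frobenius_problem Malpha c)
    & exists D : 'M[R]_m * 'M[R]_n,
        let U := block_mx (D.1 ^+ 2) 0 0 (D.2 ^+ 2) in
        [/\ unique (solution (scaling_problem A B alpha c)) D,
            (forall i, 0 < D.1 i i) /\ (forall j, 0 < D.2 j j),
            exists (a : R) (P : 'M[R]_(m + n)),
              doubly_stochastic P /\ U *m esq_mx Malpha *m U = a *: P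
          & exists (t : R) (L Rt : 'M[R]_(m + n)),
              [/\ 0 < t,
                  posdiag L /\ posdiag Rt,
                  sk_computes (esq_mx Malpha) (const_mx 1) (const_mx 1)
                    ((t *: U) *m esq_mx Malpha *m (t *: U)) L Rt,
                  L *m Rt = (t *: U) ^+ 2
                & [|| A != 0, B != 0 | m == n] ->
                  L = t *: U /\ Rt = t *: U]]].
Proof.
split.
- by apply: equivalent_scaling => // d e; exact: entry_sum_objectiveE.
- by apply: equivalent_scaling => // d e; exact: frobenius_objectiveE.
pose N := Malpha_sq A B alpha; rewrite MalphaE -/N.
have k_gt0 : (0 < m + n)%N by rewrite addn_gt0 m_gt0.
have N_sym : forall i j, N i j = N j i by exact: Malpha_sq_sym.
have N_ge0 : forall i j, 0 <= N i j by exact: Malpha_sq_ge0.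
have N_diag i : 0 < N i i by exact: Malpha_sq_clique.
have [x [a [x_gt0 xc a_gt0 x_bal]]] := exists_balanced N_sym N_ge0 N_diag k_gt0 c_gt0.
have [D Dc DE] := scaling_setP x_gt0 xc.
exists D => U; have UE : U = diag_mx x by rewrite /U (sqdiag_block Dc) DE.
have objE E : scaling_set c E ->
    objective (scaling_problem A B alpha c) E = qform N (sqdiag E).
  case: E => E1 E2 [pE1 pE2 _].
  have /= E1E := posdiag_diag_mx pE1; have /= E2E := posdiag_diag_mx pE2.
  by rewrite E1E E2E; exact: scaling_objectiveE.
have D_lt E : scaling_set c E -> sqdiag E != x ->
    qform N x < qform N (sqdiag E).
  move=> Ec Ex; apply: (balanced_lt_qform N_sym N_ge0 N_diag x_gt0 _ x_bal) => //.
    exact: sqdiag_gt0 Ec.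
  by rewrite xc (sqdiag_prod Ec).
(* With this [t] the scalar multiple [t *: U] makes the matrix itself doubly
   stochastic. *)
pose t := (Num.sqrt a)^-1.
have t_gt0 : 0 < t by rewrite invr_gt0 sqrtr_gt0.
have t2 : t ^+ 2 * a = 1.
  by rewrite exprVn sqr_sqrtr ?mulVf ?gt_eqF // ltW.
pose u := t *: x.
have u_gt0 i : 0 < u 0 i by rewrite mxE mulr_gt0.
have u_bal i : u 0 i * (\sum_j N i j * u 0 j) = 1.
  rewrite -t2 -(x_bal i) expr2 -mulrA mulrCA mulr_sumr !mulr_sumr.
  by apply: eq_bigr => j _; rewrite !mxE; ring.
have tU : t *: U = diag_mx u by rewrite UE -linearZ.
pose P := diag_mx u *m N *m diag_mx u.
split.
- split; first split=> // E Ec.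
    rewrite !objE // DE; have [->//|/(D_lt _ Ec)/ltW //] := eqVneq (sqdiag E) x.
  move=> E [Ec /(_ _ Dc)]; rewrite !objE // DE => E_le.
  apply: (sqdiag_inj Dc Ec); rewrite DE; apply/esym/eqP.
  by apply: contraLR E_le => /(D_lt _ Ec); rewrite -ltNge.
- by case: Dc => -[_ D1] [_ D2] _; split.
- exists a, P; split.
    split=> [i j|i|j].
    + exact: (scaled_mx_ge0 N_ge0 u_gt0).
    + exact: (scaled_mx_row u_bal).
    + exact: (scaled_mx_col N_sym u_bal).
  rewrite UE /P -tU UE -!scalemxAl -!scalemxAr !scalerA -mulrA -expr2.
  by rewrite mulrC t2 scale1r.
have [w [w_gt0 w_N w_cvg w_const]] :=
  sinkhorn_left_limit m_gt0 n_gt0 alpha_gt0 u_gt0 u_bal.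
pose E := sk_balance (SkState P (\row_i (u 0 i * w 0 i)) (\row_i (u 0 i / w 0 i))).
have [L_gt0 R_gt0] := balance_gt0 P k_gt0 u_gt0 w_gt0.
exists t, (diag_mx (sk_left E)), (diag_mx (sk_right E)); rewrite tU; split=> //.
- by split; exact: posdiag_diag_row.
- apply: (sk_computes_symmetric k_gt0 N_ge0 N_diag N_sym u_gt0 u_bal w_gt0 w_N).
  exact: w_cvg.
- rewrite diag_mx_sqr mulmx_diag; congr diag_mx; apply/rowP => i.
  by rewrite [LHS]mxE (balance_prod P k_gt0 u_gt0 w_gt0) [RHS]mxE.
- move=> /w_const w_c.
  by have [EL ER] := balance_const P k_gt0 u_gt0 w_gt0 w_c; rewrite EL ER.
Qed.
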